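(* For a positive integer $M$ let $\mathrm{Twin}(M)$ be the number of ordered twin pairs $(\theta,\eta)$ in $\mathbb{Z}^3$ with $N(\theta)=N(\eta)=M$. Write $M=2^\kappa p_1^{\lambda_1}\cdots p_m^{\lambda_m}q_1^{\mu_1}\cdots q_\ell^{\mu_\ell}$ with distinct primes $p_r\equiv1\pmod4$, $q_s\equiv-1\pmod4$ and all $\lambda_r,\mu_s$ positive. Then $$\mathrm{Twin}(M)=24\prod_{r=1}^m g(p_r^{\lambda_r})\prod_{s=1}^{\ell}h(q_s^{\mu_s}),$$ where $g(p^{2\lambda})=\sigma(p^\lambda)+\sigma(p^{\lambda-1})$, $g(p^{2\lambda+1})=2\sigma(p^\lambda)$, $h(q^{2\mu})=\sigma(q^\mu)+\sigma(q^{\mu-1})$, $h(q^{2\mu+1})=0$. In particular $\mathrm{Twin}(M)/24$ is a multiplicative function, and if there exists a twin pair with norm $M$, then $M$ is a sum of two squares.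
   Context: Two vectors in $\mathbb{Z}^3$ are twins if they are nonzero, orthogonal and of equal length; the norm $N$ of a vector is its squared length. $\sigma(s)$ is the sum of the positive divisors of $s$ (with $\sigma(p^{-1})$ understood as $0$, i.e. for exponent-zero terms the formula gives $\sigma(p^0)=1$). *)

(* Defs.v *)
From HB Require Import structures.
From mathcomp Require Import all_boot all_order all_algebra finmap all_classical.

Set Implicit Arguments.
Unset Strict Implicit.
Unset Printing Implicit Defensive.

Import Order.TTheory GRing.Theory Num.Theory.

Local Open Scope ring_scope.
Local Open Scope classical_set_scope.

Definition dotv (u v : 'rV[int]_3) : int := \sum_i u 0 i * v 0 i.

(* The squared Euclidean length, so [normv u = normv v] says that [u] and [v]
   have equal length. *)
Definition normv (u : 'rV[int]_3) : int := dotv u u.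

Definition twins (u v : 'rV[int]_3) : Prop :=
  [/\ u != 0, v != 0, dotv u v = 0 & normv u = normv v].

Definition twin_pairs (M : nat) : set ('rV[int]_3 * 'rV[int]_3) :=
  [set w | [/\ twins w.1 w.2, normv w.1 = M%:Z & normv w.2 = M%:Z]].

Lemma normv_bound (M : nat) (u : 'rV[int]_3) :
  normv u = M%:Z -> exists r : 'rV['I_(M + M).+1]_3,
    u = map_mx (fun k : 'I_(M + M).+1 => (k : nat)%:Z - M%:Z) r.
Proof.
move=> uM.
have ub i : `|u 0 i| <= M%:Z.
  apply: (@le_trans _ _ (u 0 i * u 0 i)).
    rewrite -[leRHS]ger0_norm; last by rewrite -expr2 sqr_ge0.
    rewrite normrM; have [->|nz] := eqVneq (u 0 i) 0; first by rewrite normr0.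
    by rewrite ler_peMr // -gtz0_ge1 normr_gt0.
  rewrite -uM /normv /dotv (bigD1 i) //= lerDl sumr_ge0 // => j _.
  by rewrite -expr2 sqr_ge0.
exists (\row_(i < 3) inord (absz (u 0 i + M%:Z))).
apply/rowP => i; rewrite !mxE.
have := ub i; rewrite ler_norml => /andP[lo hi].
have ge0 : 0 <= u 0 i + M%:Z by rewrite -lerBlDr sub0r.
rewrite inordK; first by rewrite gez0_abs // addrK.
by rewrite ltnS -lez_nat gez0_abs // PoszD lerD2r.
Qed.

Lemma finite_twin_pairs (M : nat) : finite_set (twin_pairs M).
Proof.
pose dec (r : 'rV['I_(M + M).+1]_3) : 'rV[int]_3 :=
  map_mx (fun k : 'I_(M + M).+1 => (k : nat)%:Z - M%:Z) r.
apply: (@sub_finite_set _ _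
  ((fun r : 'rV['I_(M + M).+1]_3 * 'rV['I_(M + M).+1]_3 =>
      (dec r.1, dec r.2)) @` setT)); last exact/finite_image/finite_finset.
move=> [u v] [_ /= /normv_bound[r ->] /normv_bound[s ->]].
by exists (r, s).
Qed.

(* [fset_set] returns the empty set on infinite sets; [finite_twin_pairs] rules
   this out. *)
Definition Twin (M : nat) : nat := #|` fset_set (twin_pairs M)|%fset.

Definition sigma (n : nat) : nat := (\sum_(d <- divisors n) d)%N.

(* [sigma (p ^ (e - 1))], with the convention sigma (p ^ -1) = 0. *)
Definition sigma_pred (p e : nat) : nat :=
  if e is e'.+1 then sigma (p ^ e') else 0%N.

(* [g p e] and [h q e] stand for g(p^e) and h(q^e). *)
Definition g (p e : nat) : nat :=
  if odd e then (2 * sigma (p ^ e./2))%N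
  else (sigma (p ^ e./2) + sigma_pred p e./2)%N.

Definition h (q e : nat) : nat :=
  if odd e then 0%N
  else (sigma (q ^ e./2) + sigma_pred q e./2)%N.

Definition multiplicative_fun (f : nat -> rat) : Prop :=
  f 1%N = 1 /\
  forall a b : nat, (0 < a)%N -> (0 < b)%N -> coprime a b ->
    f (a * b)%N = f a * f b.

(* Main.v *)
From HB Require Import structures.
Require Import Defs.
From mathcomp Require Import all_boot all_order all_algebra.
From mathcomp Require Import finmap all_classical all_field.
From mathcomp Require Import zify ring lra.

(* A twin pair (theta, eta) is an isotropic vector z = theta + i eta of Z[i]^3.
   With A = z1 + i z2, B = z1 - i z2 and C = i z3, isotropy reads AB = C^2, so
   unique factorization in Z[i] gives (A, B, C) = (h u^2, h v^2, h u v), where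
   the condition A = B mod 2 lets one normalize |u|^2 + |v|^2 = 2k with k odd,
   u and v having no common odd factor; then M = |h|^2 k^2, and (h, u, v) is
   unique up to a unit.  Hence
     4 Twin(M) = \sum_(k odd, k^2 | M) R2(M / k^2) P(k),
   P(k) being the number of such (u, v).  Dividing out greatest common divisors,
   \sum_(d | k) R2(d) P(k / d) = 4 R4(2k) for k odd.  Here R2 = 4 (1 * chi), by
   induction on primes, and R4(2k) = 24 sigma(k), by Dirichlet's involution on
   the solutions of dx + ey = 2k in odd numbers.  Therefore P = 24 psi with
   chi * psi = id on odd numbers, which makes psi, and then Twin / 24,
   multiplicative, with psi(p^(j+1)) = p psi(p^j) for j > 0; summing over k gives
   the values of Twin / 24 at prime powers. *)

Set Implicit Arguments.
Unset Strict Implicit.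
Unset Printing Implicit Defensive.
Import Order.TTheory GRing.Theory Num.Theory.

(** * Weighted counts over finite sets *)

Section Counting.
Local Open Scope classical_set_scope.
Local Open Scope ring_scope.

(** Orthogonality and equal length together say z1^2 + z2^2 + z3^2 = 0, so two equations over Z
    become one factorization problem over Z[i]. For coprime u and v, the number |u|^2 + |v|^2 is
    either odd or twice an odd number; multiplying u and v by 1 + i in the odd case merges the two
    cases, at the price of a possible common factor 1 + i. The only ambiguity left is a unit e,
    acting by (e^2 h, u / e, v / e), and likewise by (e c, u / e, v / e) when an odd common factor c
    is split off a pair: hence the factor 4 in both counting identities. Counts live in the
    rationals because characters are signed and because inclusion-exclusion and division by 4 and 24
    occur. *)

Lemma fsum_fibers (R : nmodType) (T I : choiceType) (A : set T) (s : seq I)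
    (f : T -> I) (F : T -> R) :
  finite_set A -> uniq s -> (forall x, A x -> f x \in s) ->
  \sum_(x \in A) F x = \sum_(i <- s) \sum_(x \in A `&` f @^-1` [set i]) F x.
Proof.
move=> finA us fs; rewrite fsbig_finite //.
have E i : \sum_(x \in A `&` f @^-1` [set i]) F x =
    \sum_(x <- fset_set A) if i == f x then F x else 0.
  rewrite fsbig_mkcondr fsbig_finite //; apply: eq_bigr => x _.
  by rewrite (_ : (x \in _) = (i == f x)) //; apply/idP/eqP; rewrite inE /=.
rewrite (eq_bigr _ (fun i _ => E i)) exchange_big /= big_seq [RHS]big_seq.
apply: eq_bigr => x; rewrite in_fset_set // inE => Ax; rewrite (big_rem (f x)) ?fs //= eqxx.
rewrite big1_seq ?addr0 // => i /andP[_ ifx]; case: eqP => // e.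
by rewrite e mem_rem_uniqF in ifx.
Qed.

Lemma fsumM (R : idomainType) (T U : choiceType) (A : set T) (B : set U)
    (F : T -> R) (G : U -> R) : finite_set A -> finite_set B ->
  \sum_(w \in A `*` B) F w.1 * G w.2 =
  (\sum_(x \in A) F x) * (\sum_(y \in B) G y).
Proof.
move=> fA fB; rewrite -(@pair_fsbig _ _ _ _ _ A B (fun x y => F x * G y)) //.
by rewrite mulr_fsuml; apply: eq_fsbigr => x _; rewrite mulr_fsumr.
Qed.

Definition cnt (T : choiceType) (A : set T) : rat := \sum_(x \in A) (1 : rat).

Lemma cnt_fset_set (T : choiceType) (A : set T) :
  finite_set A -> cnt A = (#|` fset_set A|%fset)%:R.
Proof.
by move=> fA; rewrite /cnt fsbig_finite // card_fset_sum1 natr_sum big_seq_fsetE.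
Qed.

Lemma cnt_bij (T U : choiceType) (A : set T) (B : set U) (f : T -> U) :
  set_bij A B f -> cnt A = cnt B.
Proof. by move=> bf; rewrite [RHS]/cnt (reindex_fsbig _ _ _ _ bf). Qed.

Lemma cnt_eq (T U : choiceType) (A : set T) (B : set U) (f : T -> U) (f' : U -> T) :
  (forall x, A x -> B (f x)) -> (forall y, B y -> A (f' y)) ->
  (forall x, A x -> f' (f x) = x) -> (forall y, B y -> f (f' y) = y) ->
  cnt A = cnt B.
Proof.
move=> AB BA fK f'K; apply: (@cnt_bij _ _ _ _ f); split => //.
  by move=> x y /set_mem Ax /set_mem Ay e; rewrite -(fK x) // -(fK y) // e.
by move=> y By; exists (f' y); [exact: BA|exact: f'K].
Qed.

Lemma cnt0 (T : choiceType) : cnt (@set0 T) = 0.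
Proof. by rewrite /cnt fsbig_set0. Qed.

Lemma cntID (T : choiceType) (B A : set T) :
  finite_set A -> cnt A = cnt (A `&` B) + cnt (A `&` ~` B).
Proof. by move=> fA; rewrite /cnt (fsbigID B). Qed.

Lemma cntU (T : choiceType) (A B : set T) : finite_set A -> finite_set B ->
  cnt (A `|` B) = cnt A + cnt B - cnt (A `&` B).
Proof.
move=> fA fB; have fU : finite_set (A `|` B) by rewrite finite_setU.
rewrite (cntID A fU) setUK (cntID A fB) (setIC B A) -addrA; congr (_ + _).
have -> : (A `|` B) `&` ~` A = B `&` ~` A by rewrite setIUl setICr set0U.
by rewrite [_ + cnt (B `&` _)]addrC addrK.
Qed.

Lemma cntX (T U : choiceType) (A : set T) (B : set U) :
  finite_set A -> finite_set B -> cnt (A `*` B) = cnt A * cnt B.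
Proof.
by move=> fA fB; rewrite /cnt -fsumM //; apply: eq_fsbigr => x _; rewrite mulr1.
Qed.

Lemma cnt_fibers (T I : choiceType) (A : set T) (s : seq I) (f : T -> I) :
  finite_set A -> uniq s -> (forall x, A x -> f x \in s) ->
  cnt A = \sum_(i <- s) cnt (A `&` f @^-1` [set i]).
Proof. by move=> fA us fs; rewrite /cnt (fsum_fibers _ fA us fs). Qed.

Lemma cnt_fibers_const (T U : choiceType) (A : set T) (B : set U) (f : T -> U)
    (c : rat) : finite_set A -> finite_set B -> (forall x, A x -> B (f x)) ->
  (forall y, B y -> cnt (A `&` f @^-1` [set y]) = c) ->
  cnt A = c * cnt B.
Proof.
move=> fA fB fAB fc.
rewrite (@cnt_fibers _ _ A (fset_set B) f) ?fset_uniq //; last first.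
  by move=> x Ax; rewrite in_fset_set // inE; exact: fAB.
rewrite /cnt (@fsbig_finite _ _ _ _ B) // mulr_sumr.
by apply: eq_big_seq => y; rewrite in_fset_set // inE => /fc; rewrite mulr1.
Qed.

End Counting.

(** * Gaussian integers *)

Section GaussDef.
Local Open Scope ring_scope.

Record gint := Gint { gre : int; gim : int }.

Definition gint_pair (z : gint) := (gre z, gim z).
Definition pair_gint (w : int * int) := Gint w.1 w.2.
Lemma gint_pairK : cancel gint_pair pair_gint. Proof. by case. Qed.
HB.instance Definition _ := Choice.copy gint (can_type gint_pairK).

Definition gadd x y := Gint (gre x + gre y) (gim x + gim y).
Definition gopp x := Gint (- gre x) (- gim x).
Definition gmul x y :=
  Gint (gre x * gre y - gim x * gim y) (gre x * gim y + gim x * gre y).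

Lemma gaddA : associative gadd.
Proof. by move=> [a b] [c d] [e f]; rewrite /gadd /= !addrA. Qed.
Lemma gaddC : commutative gadd.
Proof. by move=> [a b] [c d]; rewrite /gadd /= addrC [b + d]addrC. Qed.
Lemma gadd0 : left_id (Gint 0 0) gadd.
Proof. by move=> [a b]; rewrite /gadd /= !add0r. Qed.
Lemma gaddN : left_inverse (Gint 0 0) gopp gadd.
Proof. by move=> [a b]; rewrite /gadd /= !addNr. Qed.
HB.instance Definition _ := GRing.isZmodule.Build gint gaddA gaddC gadd0 gaddN.

Lemma gmulA : associative gmul.
Proof. by move=> [a b] [c d] [e f]; rewrite /gmul /=; congr Gint; ring. Qed.
Lemma gmulC : commutative gmul.
Proof. by move=> [a b] [c d]; rewrite /gmul /=; congr Gint; ring. Qed.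
Lemma gmul1 : left_id (Gint 1 0) gmul.
Proof. by move=> [a b]; rewrite /gmul /=; congr Gint; ring. Qed.
Lemma gmulDl : left_distributive gmul gadd.
Proof. by move=> [a b] [c d] [e f]; rewrite /gmul /gadd /=; congr Gint; ring. Qed.
Lemma g1_neq0 : Gint 1 0 != 0 :> gint.
Proof. by []. Qed.
HB.instance Definition _ :=
  GRing.Zmodule_isComNzRing.Build gint gmulA gmulC gmul1 gmulDl g1_neq0.

End GaussDef.

Bind Scope ring_scope with gint.

Section Gauss.
Local Open Scope ring_scope.
Implicit Types x y z u v a b d : gint.

Lemma gmulE x y :
  x * y = Gint (gre x * gre y - gim x * gim y) (gre x * gim y + gim x * gre y).
Proof. by []. Qed.
Lemma goppE x : - x = Gint (- gre x) (- gim x).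
Proof. by []. Qed.
Lemma gint1E : 1 = Gint 1 0. Proof. by []. Qed.
Lemma gintP x y : gre x = gre y -> gim x = gim y -> x = y.
Proof. by case: x y => [a b] [c d] /= -> ->. Qed.

Definition gconj z := Gint (gre z) (- gim z).
Definition gn z : nat := (absz (gre z) ^ 2 + absz (gim z) ^ 2)%N.
Definition gnat (n : nat) : gint := Gint n%:Z 0.

Lemma gnE z : (gn z)%:Z = gre z ^+ 2 + gim z ^+ 2.
Proof. by rewrite /gn PoszD -!abszX !gez0_abs ?sqr_ge0. Qed.

Lemma gnM x y : gn (x * y) = (gn x * gn y)%N.
Proof. by apply/eqP; rewrite -eqz_nat PoszM !gnE /=; apply/eqP; ring. Qed.

Lemma gn0 : gn 0 = 0%N. Proof. by []. Qed.
Lemma gn_conj z : gn (gconj z) = gn z.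
Proof. by rewrite /gn /= abszN. Qed.
Lemma gn_nat n : gn (gnat n) = (n ^ 2)%N.
Proof. by rewrite /gn /= addn0. Qed.
Lemma mul_conj z : z * gconj z = gnat (gn z).
Proof. by rewrite /gnat gnE gmulE /=; congr Gint; ring. Qed.
Lemma gn_eq0 z : (gn z == 0%N) = (z == 0).
Proof.
apply/eqP/eqP => [|->] // /eqP; rewrite /gn addn_eq0 !expn_eq0 /= !absz_eq0.
by rewrite !andbT; case: z => a b /= /andP[/eqP-> /eqP->].
Qed.
Lemma gn_gt0 z : (0 < gn z)%N = (z != 0).
Proof. by rewrite lt0n gn_eq0. Qed.
Lemma gmul_eq0 x y : x * y = 0 -> x = 0 \/ y = 0.
Proof.
move/eqP; rewrite -gn_eq0 gnM muln_eq0 !gn_eq0 => /orP[]/eqP; by [left|right].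
Qed.
Lemma gmulI x y z : x != 0 -> x * y = x * z -> y = z.
Proof.
move=> x0 e; have: x * (y - z) = 0 by rewrite mulrBr e subrr.
by case/gmul_eq0 => [/eqP|/eqP]; rewrite ?(negbTE x0) // subr_eq0 => /eqP.
Qed.

Definition gdvd x y := exists z, y = z * x.

Lemma gdiv_near (m : int) (n : nat) : (0 < n)%N ->
  exists q : int, 4%:R * (m - q * n%:Z) ^+ 2 <= (n%:Z) ^+ 2.
Proof.
(* The floor of m / n + 1 / 2, an integer nearest to m / n. *)
move=> n0; exists (divz (2 * m + n%:Z) (2 * n%:Z)).
have := divz_eq (2 * m + n%:Z) (2 * n%:Z).
have := modz_ge0 (2 * m + n%:Z) (_ : 2 * n%:Z != 0).
have := ltz_pmod (2 * m + n%:Z) (_ : 0 < 2 * n%:Z).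
move: (divz _ _) (modz _ _) => q r H1 H2 H3.
have {}H1 := H1 ltac:(lia). have {}H2 := H2 ltac:(lia).
have e : 2 * (m - q * n%:Z) = r - n%:Z by lia.
rewrite (_ : 4%:R * _ = (r - n%:Z) ^+ 2); last by rewrite -e; ring.
nia.
Qed.

(** Multiplying by [gconj y] turns the divisor into the integer [gn y]; rounding both coordinates of
    [x * gconj y] leaves a remainder of norm at most half of (gn y)^2. *)
Lemma gdivision x y : y != 0 -> exists q, (gn (x - q * y) < gn y)%N.
Proof.
move=> y0; have n0 : (0 < gn y)%N by rewrite gn_gt0.
have [q1 h1] := gdiv_near (gre (x * gconj y)) n0.
have [q2 h2] := gdiv_near (gim (x * gconj y)) n0.
exists (Gint q1 q2); rewrite -(ltn_pmul2r n0).
rewrite -{1}(gn_conj y) -gnM.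
have -> : (x - Gint q1 q2 * y) * gconj y = x * gconj y - Gint q1 q2 * gnat (gn y).
  by rewrite -mul_conj; ring.
rewrite -ltz_nat PoszM gnE; move: h1 h2 n0.
move: (x * gconj y) (gn y) => w n; rewrite /= !mulr0 subr0 add0r => h1 h2 n0.
have : 0 < n%:Z ^+ 2 by rewrite exprn_gt0 // ltz_nat.
move: h1 h2; rewrite !expr2; lia.
Qed.

(** Bezout stands in for unique factorization: Euclid's lemma, the splitting of primes and the
    factorization of isotropic triples are all drawn from it. *)
Lemma gbezout x y : exists d a b, [/\ d = a * x + b * y, gdvd d x & gdvd d y].
Proof.
have [n] := ubnP (gn y); elim: n x y => // n IH x y /ltnSE hy.
have [->|y0] := eqVneq y 0.
  by exists x, 1, 0; split; [ring|exists 1; ring|exists 0; ring].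
have [q hq] := gdivision x y0.
have [d [a [b [e [c hc] [f hf]]]]] := IH y (x - q * y) (leq_trans hq hy).
exists d, b, (a - b * q); split.
- by rewrite e; ring.
- by exists (f + q * c); rewrite mulrDl -hf -mulrA -hc; ring.
- by exists c.
Qed.

End Gauss.

(** * Sums of two squares *)

Section TwoSquares.
Local Open Scope classical_set_scope.
Local Open Scope ring_scope.
Implicit Types x y z u v a b d : gint.

Lemma cnt_seq (T : choiceType) (s : seq T) : uniq s -> cnt [set` s] = (size s)%:R.
Proof. by move=> us; rewrite /cnt -fsbig_seq // -sum1_size natr_sum. Qed.

Lemma gdvd_mull x y z : gdvd x y -> gdvd x (z * y).
Proof. by case=> w ->; exists (z * w); ring. Qed.
Lemma gdvd_add x y z : gdvd x y -> gdvd x z -> gdvd x (y + z).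
Proof. by case=> v -> [w ->]; exists (v + w); ring. Qed.
Lemma gdvd_gn x y : gdvd x y -> (gn x %| gn y)%N.
Proof. by case=> z ->; rewrite gnM dvdn_mull. Qed.

Lemma gconjM x y : gconj (x * y) = gconj x * gconj y.
Proof. by apply: gintP; rewrite !gmulE /=; ring. Qed.
Lemma gconjK x : gconj (gconj x) = x.
Proof. by apply: gintP; rewrite //= opprK. Qed.
Lemma gdvd_conj x y : gdvd (gconj x) (gconj y) -> gdvd x y.
Proof. by case=> z e; exists (gconj z); rewrite -[y]gconjK e gconjM gconjK. Qed.

Lemma gunit_inv x : gn x = 1%N -> x * gconj x = 1.
Proof. by move=> e; rewrite mul_conj e. Qed.

Definition ball n := [set z | (gn z <= n)%N].
Definition S2 n := [set z | gn z = n].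

Lemma finite_ball n : finite_set (ball n).
Proof.
pose f (w : 'I_(n + n).+1 * 'I_(n + n).+1) :=
  Gint ((w.1 : nat)%:Z - n%:Z) ((w.2 : nat)%:Z - n%:Z).
apply: (@sub_finite_set _ _ (f @` setT)); last exact/finite_image/finite_finset.
move=> [a b] /=; rewrite /ball /= /gn /= => ab.
have [ha hb] : (absz a <= n /\ absz b <= n)%N by split; nia.
exists (inord (absz (a + n%:Z)), inord (absz (b + n%:Z))) => //.
by rewrite /f /= !inordK; [congr Gint; lia|lia|lia].
Qed.

Lemma finite_S2 n : finite_set (S2 n).
Proof. by apply: sub_finite_set (finite_ball n) => z /= <-; exact: leqnn. Qed.

Definition R2 n : rat := cnt (S2 n).

Lemma R2_1 : R2 1 = 4%:R.
Proof.
rewrite -(@cnt_seq _ [:: 1; -1; Gint 0 1; Gint 0 (-1)]) //.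
congr cnt; apply/seteqP; split=> [[a b]|z] /=; rewrite !inE; last first.
  by move=> /or4P[] /eqP->.
rewrite /S2 /= /gn /= => h.
have : (absz a = 1 /\ absz b = 0)%N \/ (absz a = 0 /\ absz b = 1)%N by nia.
rewrite gint1E goppE /= => -[] [ha hb].
  have -> : b = 0 by lia.
  have [->|->] : a = 1 \/ a = -1 by lia.
    by rewrite eqxx.
  by rewrite eqxx orbT.
have -> : a = 0 by lia.
have [->|->] : b = 1 \/ b = -1 by lia.
  by rewrite eqxx !orbT.
by rewrite eqxx !orbT.
Qed.

Lemma cnt_S2_dvd x n : x != 0 ->
  cnt (S2 (gn x * n) `&` [set z | gdvd x z]) = R2 n.
Proof.
move=> x0.
have -> : S2 (gn x * n) `&` [set z | gdvd x z] = (fun z => z * x) @` S2 n.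
  apply/seteqP; split=> [w [+ [z zw]]|_ [z hz <-]]; [rewrite zw|].
    rewrite /S2 /= gnM mulnC => /eqP; rewrite eqn_pmul2l ?gn_gt0 // => /eqP e.
    by exists z.
  by split; [rewrite /S2 /= gnM hz mulnC|exists z].
apply/esym/(cnt_bij (f := fun z => z * x))/inj_bij => y z _ _.
by rewrite ![_ * x]mulrC; exact: gmulI.
Qed.

Lemma int_sqr_parity (a : int) : exists k, a ^+ 2 = a + 2 * k.
Proof.
pose b := divz a 2; have [->|->] : a = 2 * b \/ a = 2 * b + 1 by rewrite /b; lia.
  by exists (2 * b ^+ 2 - b); ring.
by exists (2 * b ^+ 2 + b); ring.
Qed.

(** The prime [Gint 1 1], of norm 2, divides every Gaussian integer of even norm. *)
Lemma R2_double n : R2 (2 * n) = R2 n.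
Proof.
rewrite -[RHS](@cnt_S2_dvd (Gint 1 1)) //; congr cnt.
apply/seteqP; split => [z hz|z []//]; split=> //.
have h : gre z ^+ 2 + gim z ^+ 2 = 2 * n%:Z by rewrite -gnE hz; lia.
exists (Gint (divz (gre z + gim z) 2) (divz (gim z - gre z) 2)).
have e : exists k, gre z + gim z = 2 * k.
  have [k1 h1] := int_sqr_parity (gre z); have [k2 h2] := int_sqr_parity (gim z).
  by exists (n%:Z - k1 - k2); lia.
by case: e => k e; apply: gintP; rewrite gmulE /=; lia.
Qed.

(** * Square roots of -1 modulo p *)

Section FpSquares.
Variables (p : nat) (pr_p : prime p).

Lemma Fp_nat_eq0 (n : nat) : ((n%:R : 'F_p) == 0) = (p %| n)%N.
Proof. by rewrite -(dvdn_pcharf (pchar_Fp pr_p)). Qed.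

(** The equation [p = n] lets the exponent be rewritten without touching the type ['F_p]. *)
Lemma Fp_exp (x : 'F_p) n : p = n -> x ^+ n = x.
Proof. by move=> <-; have := expf_card x; rewrite card_Fp. Qed.

(** Otherwise x = a / b satisfies x^2 = -1; as (p - 1) / 2 is odd, Fermat gives x = x^p = -x, so 2 x
    = 0. *)
Lemma Fp_norm_eq0 (a b : nat) : p = 3 %[mod 4] ->
  (p %| a ^ 2 + b ^ 2)%N -> (p %| b)%N.
Proof.
move=> p3; rewrite -!Fp_nat_eq0 natrD !natrX => /eqP ab.
apply/eqP; apply: contrapT => /eqP b0.
have [x x2] : exists x : 'F_p, x ^+ 2 = -1.
  exists (a%:R / b%:R); rewrite expr_div_n -[a%:R ^+ 2](addrK (b%:R ^+ 2)) ab sub0r.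
  by rewrite mulNr divff // expf_neq0.
have pE : p = (2 * (2 * (p %/ 4) + 1) + 1)%N by move: p3;
  rewrite (modn_small (m := 3)) //; lia.
have := Fp_exp x pE; rewrite exprD exprM x2 exprD exprM sqrrN !expr1n !expr1 mul1r mulN1r.
move/eqP; rewrite eq_sym -subr_eq0 opprK -mulr2n -mulr_natl mulf_eq0 Fp_nat_eq0.
case/orP => [|/eqP x0]; last by move/eqP: x2; rewrite x0 expr0n eq_sym oppr_eq0 oner_eq0.
by move/(dvdn_leq (isT : (0 < 2)%N)); move: p3; rewrite (modn_small (m := 3)) //; lia.
Qed.

(** With p = 4 k + 1, the polynomial X^(2k) - 1 cannot vanish at all 4 k nonzero elements. If y is
    not a root, then y^(4k) = 1 forces y^(2k) = -1, and y^k is the square root. *)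
Lemma Fp_sqrtN1 : p = 1 %[mod 4] -> exists t : nat, (p %| t ^ 2 + 1)%N.
Proof.
move=> p1; have p_gt1 := prime_gt1 pr_p.
have pE : p = (4 * (p %/ 4) + 1)%N by move: p1; rewrite (modn_small (m := 1)) //; lia.
set k := (p %/ 4)%N in pE; have k0 : (0 < k)%N by lia.
have [y y0 yk] : exists2 y : 'F_p, y != 0 & y ^+ (2 * k) != 1.
  apply: contrapT => H.
  pose P : {poly 'F_p} := 'X^(2 * k) - 1.
  have sP : size P = (2 * k).+1 by rewrite size_XnsubC //; lia.
  have P0 : P != 0 by rewrite -size_poly_gt0 sP.
  pose rs := [seq y <- enum 'F_p | y != 0].
  have : (size rs < size P)%N.
    apply: max_poly_roots => //; last by rewrite filter_uniq // enum_uniq.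
    apply/allP => y; rewrite mem_filter => /andP[y0 _].
    rewrite /root /P !hornerE subr_eq0; apply: contrapT => /negP yk.
    by apply: H; exists y.
  rewrite sP size_filter.
  have := count_predC (pred1 (0 : 'F_p)) (enum 'F_p).
  rewrite -cardE card_Fp // count_uniq_mem ?enum_uniq // mem_enum inE => e.
  move=> /(leq_trans _); move/(_ _ (leqnn _)); rewrite -[X in (X < _)%N](addKn 1) e.
  by lia.
pose t := y ^+ k.
have t2 : t ^+ 2 = -1.
  have : y ^+ (4 * k) = 1.
    have := Fp_exp y pE; rewrite exprD expr1 => /eqP;
      rewrite -subr_eq0 -[X in _ - X]mul1r -mulrBl mulf_eq0.
    by rewrite (negbTE y0) orbF subr_eq0 => /eqP.
  rewrite (_ : 4 * k = (2 * k) * 2)%N; last by lia.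
  rewrite exprM => /eqP; rewrite -subr_eq0 -(expr1n _ 2) subr_sqr mulf_eq0 subr_eq0.
  by rewrite (negbTE yk) /= addr_eq0 mulnC exprM expr1n => /eqP.
exists (val t); rewrite -Fp_nat_eq0 natrD natrX natr_Zp t2.
by rewrite addNr.
Qed.

End FpSquares.
End TwoSquares.

(** * Primes of Z[i] and the recursion of R2 at a prime *)

Section Hecke.
Local Open Scope classical_set_scope.
Local Open Scope ring_scope.
Implicit Types x y z u v a b d : gint.

Lemma gnatM m n : gnat (m * n) = gnat m * gnat n.
Proof. by apply: gintP; rewrite gmulE /= ?PoszM; ring. Qed.

Lemma gdvd_nat n z : gdvd (gnat n) z <-> (n %| absz (gre z))%N /\ (n %| absz (gim z))%N.
Proof.
split=> [[w ->]|[]].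
  by rewrite gmulE /= !mulr0 subr0 add0r !abszM !dvdn_mull.
rewrite -![(n %| _)%N]/(dvdz n%:Z _) => /dvdzP[q hq] /dvdzP[q' hq'].
by exists (Gint q q'); apply: gintP; rewrite gmulE /= ?hq ?hq'; ring.
Qed.

(** The norm of a gcd of x and y divides the prime [gn x]. If it is 1, Bezout multiplied by z shows
    that x divides z; otherwise the gcd is an associate of x. *)
Lemma gprime_dvdM x y z : prime (gn x) -> gdvd x (y * z) -> gdvd x y \/ gdvd x z.
Proof.
move=> pr_x [w hw]; have [d [a [b [hd hx [e he]]]]] := gbezout x y.
have /orP[/eqP d1|/eqP dx] : (gn d == 1%N) || (gn d == gn x).
  by apply: (primeP pr_x).2; exact: gdvd_gn.
  right; exists (gconj d * (a * z + b * w)).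
  rewrite -[LHS]mulr1 -(gunit_inv d1) hd mulrA.
  rewrite (_ : z * _ = a * z * x + b * (y * z)); last by ring.
  by rewrite hw; ring.
left; case: hx => f hf.
have f1 : gn f = 1%N.
  apply/eqP; rewrite -(eqn_pmul2r (prime_gt0 pr_x)) mul1n {1}[in X in _ == X]hf gnM dx.
  by [].
by exists (e * gconj f);
  rewrite hf he -mulrA [gconj f * _]mulrA [gconj f * f]mulrC gunit_inv // mul1r.
Qed.

(** A gcd of p and y = t + i has norm dividing p^2. Norm 1 would give p | [gconj y] through Bezout,
    and norm p^2 would give p | y; both fail since the imaginary parts are -1 and 1. *)
Lemma exists_gprime p : prime p -> p = 1 %[mod 4] -> exists x, gn x = p.
Proof.
move=> pr_p /(Fp_sqrtN1 pr_p)[t /dvdnP[w tp]].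
pose y := Gint t%:Z 1; have gy : y * gconj y = gnat w * gnat p.
  by rewrite -gnatM -tp mul_conj; congr gnat; rewrite /gn /=; lia.
have nd : ~ gdvd (gnat p) (gconj y).
  case/gdvd_nat => _ /=; rewrite dvdn1 => /eqP p1.
  by rewrite p1 in pr_p.
have nd' : ~ gdvd (gnat p) y.
  by case/gdvd_nat => _ /=; rewrite dvdn1 => /eqP p1; rewrite p1 in pr_p.
have [d [a [b [hd [f hf] [e he]]]]] := gbezout (gnat p) y.
exists d.
have : (gn d %| p ^ 2)%N by rewrite -(gn_nat p); apply: gdvd_gn; exists f.
case/(dvdn_pfactor _ _ pr_p) => -[|[|[|//]]] _ dp; rewrite dp //.
- case: nd; exists (gconj d * (a * gconj y + b * gnat w)).
  rewrite -[LHS]mulr1 -(gunit_inv dp) hd mulrA.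
  rewrite (_ : gconj y * _ = a * gconj y * gnat p + b * (y * gconj y)); last by ring.
  by rewrite gy; ring.
- case: nd'.
  have f1 : gn f = 1%N.
    apply/eqP; rewrite -(@eqn_pmul2r (p ^ 2)) ?expn_gt0 ?prime_gt0 //.
    by rewrite -{1}dp -gnM -hf gn_nat mul1n.
  by exists (e * gconj f);
    rewrite hf he -mulrA [gconj f * _]mulrA [gconj f * f]mulrC gunit_inv // mul1r.
Qed.

(** If x divides its conjugate, it divides 2 [gre x]; then p divides both coordinates of x, and p^2
    divides p. So x and its conjugate are not associates, which makes divisibility by both the same
    as divisibility by p. *)
Lemma gprime_conj p x : prime p -> (2 < p)%N -> gn x = p -> ~ gdvd x (gconj x).
Proof.
move=> pr_p p2 xp [w hw].
have : (p %| gn (Gint (2 * gre x) 0))%N.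
  rewrite -xp; apply: gdvd_gn; exists (1 + w).
  by rewrite [RHS]mulrDl -hw mul1r; apply: gintP; rewrite /=; ring.
rewrite /gn /= addn0 abszM expnMn Euclid_dvdM // !Euclid_dvdX // !andbT.
case/orP => [/(dvdn_leq (isT : (0 < 2)%N))|/dvdnP[k hk]]; first by lia.
have := xp; rewrite /gn hk => hp.
have pb : (p %| absz (gim x) ^ 2)%N.
  by rewrite -(@dvdn_addr ((k * p) ^ 2)) ?hp // expnMn dvdn_mull // dvdn_mulr.
move: pb; rewrite Euclid_dvdX // andbT => /dvdnP[l hl].
move: hp; rewrite hl => hp; have : (p * (k ^ 2 + l ^ 2) = 1)%N.
  by apply/eqP; rewrite -(eqn_pmul2r (prime_gt0 pr_p)) mul1n -[X in _ == X]hp; apply/eqP;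
    ring.
by move/eqP; rewrite muln_eq1 => /andP[/eqP p1]; rewrite p1 in pr_p.
Qed.

Lemma gdvd_conjM p x z : prime p -> (2 < p)%N -> gn x = p ->
  gdvd x z -> gdvd (gconj x) z -> gdvd (gnat p) z.
Proof.
move=> pr_p p2 xp [u hu] hz; case: (hz) => v hv.
have : gdvd (gconj x) (u * x) by rewrite -hu.
case/gprime_dvdM; rewrite ?gn_conj ?xp //.
  by case=> w hw; exists w; rewrite hu hw -mulrA [gconj x * x]mulrC mul_conj xp.
by move=> h; case: (@gprime_conj p (gconj x)) => //; rewrite ?gn_conj ?gconjK.
Qed.

(** The nontrivial Dirichlet character modulo 4. *)
Definition chi (n : nat) : rat :=
  if (n %% 4 == 1)%N then 1 else if (n %% 4 == 3)%N then -1 else 0.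

Lemma chiM m n : chi (m * n) = chi m * chi n.
Proof.
rewrite /chi -modnMm.
have: (m %% 4 < 4)%N by rewrite ltn_mod.
have: (n %% 4 < 4)%N by rewrite ltn_mod.
case: (n %% 4)%N => [|[|[|[|//]]]] _; case: (m %% 4)%N => [|[|[|[|//]]]] _ //.
Qed.

(* For p = 1 mod 4 with p = x * conj x, an element of norm p n is divisible by x
   or by conj x, and by both exactly when it is divisible by p; for p = 3 mod 4
   it is always divisible by p. *)
Lemma R2_prime p n : prime p ->
  R2 (p * n) = (1 + chi p) * R2 n - chi p * (if (p %| n)%N then R2 (n %/ p) else 0).
Proof.
move=> pr_p; have p_gt0 := prime_gt0 pr_p.
have cnt_p : cnt (S2 (p * n) `&` [set z | gdvd (gnat p) z]) =
    if (p %| n)%N then R2 (n %/ p) else 0.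
  case: ifP => pn.
    rewrite -(@cnt_S2_dvd (gnat p)); last first.
      by rewrite -gn_gt0 gn_nat expn_gt0 p_gt0.
    by rewrite gn_nat -mulnn -mulnA [(p * (n %/ p))%N]mulnC divnK.
  rewrite (_ : _ `&` _ = set0) ?cnt0 //; apply/seteqP; split=> // z [hz /gdvd_gn].
  by rewrite hz gn_nat -mulnn dvdn_pmul2l // pn.
have [p2|p_neq2] := eqVneq p 2%N.
  by rewrite p2 R2_double /chi /= addr0 mul1r mul0r subr0.
have p_gt2 : (2 < p)%N by have := prime_gt1 pr_p; lia.
have /orP[] : (p %% 4 == 1)%N || (p %% 4 == 3)%N.
  have [] := primeP pr_p => _ /(_ 2%N); lia.
  move=> p1; have [x xp] := exists_gprime pr_p (eqP p1).
  rewrite /chi p1.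
  have x0 : x != 0 by rewrite -gn_gt0 xp.
  have x0' : gconj x != 0 by rewrite -gn_gt0 gn_conj xp.
  pose D y := S2 (p * n) `&` [set z | gdvd y z].
  have fD y : finite_set (D y) by apply: finite_setIl; exact: finite_S2.
  have E : S2 (p * n) = D x `|` D (gconj x).
    apply/seteqP; split=> [z hz|z [] []//].
    have : gdvd x (z * gconj z) by rewrite mul_conj hz gnatM -xp -mul_conj;
      exists (gconj x * gnat n); ring.
    case/gprime_dvdM; rewrite ?xp //; first by left.
    by rewrite -{1}[x]gconjK => /gdvd_conj; right.
  rewrite /R2 E cntU // -cnt_p.
  have := cnt_S2_dvd n x0; have := cnt_S2_dvd n x0';
    rewrite gn_conj xp -/(D x) -/(D (gconj x)) => -> ->.
  rewrite (_ : D x `&` D (gconj x) = S2 (p * n) `&` [set z | gdvd (gnat p) z]).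
    by rewrite -/(R2 n); ring.
  apply/seteqP; split=> [z [[hz h1] [_ h2]]|z [hz h]].
    by split=> //; exact: gdvd_conjM xp h1 h2.
  rewrite -xp -mul_conj in h; split; split=> //.
    by case: h => w ->; exists (w * gconj x); ring.
  by case: h => w ->; exists (w * x); ring.
move=> p3; rewrite /chi p3 (_ : (p %% 4 == 1)%N = false); last by lia.
rewrite subrr mul0r sub0r mulN1r opprK -cnt_p; congr cnt.
apply/seteqP; split=> [z hz|z []//]; split=> //; apply/gdvd_nat.
have pz : (p %| absz (gre z) ^ 2 + absz (gim z) ^ 2)%N by rewrite -/(gn z) hz dvdn_mulr.
by split; apply: Fp_norm_eq0 (eqP p3) _ => //; [rewrite addnC|]; exact: pz.
Qed.

End Hecke.

(** * Divisor sums *)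

Section DivisorSums.
Local Open Scope ring_scope.
Variable R : zmodType.
Implicit Types F : nat -> R.

Lemma sum_divisorsM a b F : (0 < a)%N -> (0 < b)%N -> coprime a b ->
  \sum_(d <- divisors (a * b)) F d =
  \sum_(d <- divisors a) \sum_(e <- divisors b) F (d * e)%N.
Proof.
move=> a0 b0 ab.
transitivity (\sum_(x <- [seq (d * e)%N | d <- divisors a, e <- divisors b]) F x);
  last by rewrite big_allpairs_dep.
(* Gcds with a and with b recover the two factors of a divisor of a b. *)
have gcdE d e : (d %| a)%N -> (e %| b)%N ->
    gcdn (d * e) a = d /\ gcdn (d * e) b = e.
  move=> da eb; split.
    by rewrite gcdnC Gauss_gcdl ?(coprime_dvdr eb) //; apply/gcdn_idPr.
  by rewrite gcdnC Gauss_gcdr ?(coprime_dvdr da) 1?coprime_sym //; apply/gcdn_idPr.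
apply: perm_big; apply: uniq_perm.
- exact: divisors_uniq.
- apply: allpairs_uniq; rewrite ?divisors_uniq //.
  move=> [d e] [d' e'] /allpairsP[[x1 y1] [/= + + [-> ->]]].
  rewrite -!dvdn_divisors // => hd he.
  move=> /allpairsP[[x2 y2] [/= + + [-> ->]]].
  rewrite -!dvdn_divisors // => hd' he' /= e1.
  have [h1 h2] := gcdE _ _ hd he; have [h3 h4] := gcdE _ _ hd' he'.
  by congr pair; [rewrite -h1 e1 h3|rewrite -h2 e1 h4].
- move=> d; rewrite -dvdn_divisors ?muln_gt0 ?a0 //; apply/idP/allpairsP => [dab|].
    exists (gcdn d a, gcdn d b); rewrite /= -!dvdn_divisors // !dvdn_gcdr; split=> //.
    have cg : coprime (gcdn d a) (gcdn d b).
      by apply: coprime_dvdl (dvdn_gcdr _ _) (coprime_dvdr (dvdn_gcdr _ _) ab).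
    apply/eqP; rewrite eqn_dvd Gauss_dvd // !dvdn_gcdl andbT.
    by rewrite muln_gcdr dvdn_gcd dvdn_mull //= muln_gcdl dvdn_gcd dab dvdn_mulr.
  by case=> [[x y] [/= + + ->]]; rewrite -!dvdn_divisors //; exact: dvdn_mul.
Qed.

Lemma sum_divisorsX p n F : prime p ->
  \sum_(d <- divisors (p ^ n)) F d = \sum_(j < n.+1) F (p ^ j)%N.
Proof.
move=> pr_p; rewrite -(big_mkord xpredT (fun j =>
  F (p ^ j)%N)) -(big_map (expn p) xpredT F).
apply: perm_big; apply: uniq_perm.
- exact: divisors_uniq.
- rewrite map_inj_uniq ?iota_uniq // => i j; exact/expnI/prime_gt1.
- move=> d; rewrite -dvdn_divisors ?expn_gt0 ?prime_gt0 //.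
  apply/idP/mapP => [/(dvdn_pfactor _ _ pr_p)[m mn ->]|[m]].
    by exists m; rewrite // mem_index_iota.
  by rewrite mem_index_iota => /andP[_ mn] ->; rewrite dvdn_exp2l.
Qed.

(** Inclusion-exclusion: the divisors of p n are those of n and their multiples by p, and p d is
    counted twice exactly when d divides n / p. The shape is that of [R2_prime]. *)
Lemma sum_divisors_prime p n F : prime p -> (0 < n)%N ->
  \sum_(d <- divisors (p * n)) F d =
  \sum_(d <- divisors n) F d + \sum_(d <- divisors n) F (p * d)%N
  - (if (p %| n)%N then \sum_(d <- divisors (n %/ p)) F (p * d)%N else 0).
Proof.
move=> pr_p n0; have p0 := prime_gt0 pr_p.
pose s := [seq d <- divisors n | ~~ (p * d %| n)%N].
rewrite (perm_big (divisors n ++ [seq (p * d)%N | d <- s])); last first.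
  apply: uniq_perm; first exact: divisors_uniq.
    rewrite cat_uniq divisors_uniq map_inj_uniq ?filter_uniq ?divisors_uniq ?andbT //=.
      apply/hasPn => _ /mapP[d + ->]; rewrite mem_filter => /andP[+ _].
      by rewrite -dvdn_divisors.
    by move=> x y /eqP; rewrite eqn_pmul2l // => /eqP.
  move=> d; rewrite mem_cat -!dvdn_divisors ?muln_gt0 ?p0 //.
  apply/idP/orP => [dpn|[|/mapP[e]]].
  - have [pd|pd] := boolP (p %| d)%N; last first.
      by left; rewrite -(@Gauss_dvdr _ p) // coprime_sym prime_coprime.
    case/dvdnP: pd dpn => e ->; rewrite mulnC dvdn_pmul2l // => en.
    have [pen|pen] := boolP (p * e %| n)%N; first by left.
    by right; apply: map_f; rewrite mem_filter pen -dvdn_divisors.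
  - exact: dvdn_mull.
  - by rewrite mem_filter -dvdn_divisors // => /andP[_ en] ->; rewrite dvdn_pmul2l.
rewrite big_cat big_map big_filter /= -addrA; congr (_ + _).
rewrite [in RHS](bigID (fun d => p * d %| n)%N) /=.
set A := (X in X + _ - _); set C := if _ then _ else _.
suff -> : C = A by rewrite addrAC subrr add0r.
rewrite /C /A; case: ifPn => pn; last first.
  rewrite big1 // => d pd; case/negP: pn; exact: dvdn_trans (dvdn_mulr _ _) pd.
rewrite -[RHS]big_filter; apply: perm_big; apply: uniq_perm.
- exact: divisors_uniq.
- by rewrite filter_uniq ?divisors_uniq.
- have np0 : (0 < n %/ p)%N by rewrite divn_gt0 // dvdn_leq.
  move=> d; rewrite mem_filter -!dvdn_divisors //.
  rewrite -{2}(divnK pn) [(_ * p)%N]mulnC dvdn_pmul2l //.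
  by apply/idP/andP => [h|[]//]; split=> //; apply: dvdn_trans h (dvdn_div pn).
Qed.

Lemma sum_divisors_rev n F : (0 < n)%N ->
  \sum_(d <- divisors n) F d = \sum_(d <- divisors n) F (n %/ d)%N.
Proof.
move=> n0; rewrite -(big_map (divn n) xpredT F).
have inv d : (d %| n)%N -> (n %/ (n %/ d))%N = d.
  by move=> dn; rewrite divnA // mulKn.
apply: perm_big; apply: uniq_perm; first exact: divisors_uniq.
  rewrite map_inj_in_uniq ?divisors_uniq // => x y; rewrite -!dvdn_divisors // => hx hy e.
  by rewrite -(inv x) // e inv.
move=> d; rewrite -dvdn_divisors //; apply/idP/mapP => [dn|[e]].
  by exists (n %/ d)%N; rewrite ?inv // -dvdn_divisors // dvdn_div.
by rewrite -dvdn_divisors // => en ->; rewrite dvdn_div.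
Qed.

Lemma sum_divisors1 n F : (0 < n)%N -> (forall d, (d %| n)%N -> d != 1%N -> F d = 0) ->
  \sum_(d <- divisors n) F d = F 1%N.
Proof.
move=> n0 H; rewrite (big_rem 1%N) ?divisor1 //= big1_seq ?addr0 //.
move=> d; rewrite mem_rem_uniq ?divisors_uniq // !inE -dvdn_divisors // => /and3P[_ d1 dn].
exact: H.
Qed.

End DivisorSums.

(** * The two-square theorem R2 = 4 (1 * chi) *)

Section RepresentationByDivisors.
Local Open Scope ring_scope.

Definition chi_sum (n : nat) : rat := \sum_(d <- divisors n) chi d.

(** The recursion of [R2_prime], which together with the value at 1 determines the function on
    positive integers. *)
Lemma chi_sum_prime p n : prime p -> (0 < n)%N ->
  chi_sum (p * n) = (1 + chi p) * chi_sum n - chi p * (if (p %| n)%N then chi_sum (n %/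
    p) else 0).
Proof.
move=> pr_p n0; rewrite /chi_sum sum_divisors_prime //.
under [X in _ + X - _]eq_bigr do rewrite chiM.
under [X in _ - (if _ then X else _)]eq_bigr do rewrite chiM.
by case: ifP => _; rewrite -?mulr_sumr mulrDl mul1r ?mulr0.
Qed.

Lemma R2E n : (0 < n)%N -> R2 n = 4%:R * chi_sum n.
Proof.
have [m] := ubnP n; elim: m n => // m IH n /ltnSE nm n0.
have [->|n1] := eqVneq n 1%N; first by rewrite R2_1 /chi_sum big_seq1 /chi /= mulr1.
have pr_p : prime (pdiv n) by apply: pdiv_prime; lia.
move: (pdiv n) pr_p (pdiv_dvd n) => p pr_p pn; have p1 := prime_gt1 pr_p.
rewrite -(divnK pn) mulnC; set k := (n %/ p)%N.
have k0 : (0 < k)%N by rewrite divn_gt0 ?prime_gt0 // dvdn_leq.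
have kn : (k < n)%N by rewrite ltn_Pdiv.
rewrite R2_prime // chi_sum_prime // IH //; last by exact: leq_trans kn nm.
case: ifP => pk; last by ring.
rewrite IH; [ring| |by rewrite divn_gt0 ?prime_gt0 // dvdn_leq].
exact: leq_trans (leq_ltn_trans (leq_div _ _) kn) nm.
Qed.

End RepresentationByDivisors.

(** * Dirichlet's involution *)

Section DirichletInvolution.
Local Open Scope classical_set_scope.
Local Open Scope ring_scope.

Lemma fsum_eq (R : nmodType) (T U : choiceType) (A : set T) (B : set U) (f : T -> U)
    (f' : U -> T) (F : T -> R) (G : U -> R) :
  (forall x, A x -> B (f x)) -> (forall y, B y -> A (f' y)) ->
  (forall x, A x -> f' (f x) = x) -> (forall y, B y -> f (f' y) = y) ->
  (forall x, A x -> F x = G (f x)) ->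
  \sum_(x \in A) F x = \sum_(y \in B) G y.
Proof.
move=> AB BA fK f'K FG; rewrite (@reindex_fsbig _ _ _ _ _ f A B).
  by apply: eq_fsbigr => x /set_mem; exact: FG.
split => //.
  by move=> x y /set_mem Ax /set_mem Ay e; rewrite -(fK x) // -(fK y) // e.
by move=> y By; exists (f' y); [exact: BA|exact: f'K].
Qed.

Lemma finite_nat_pairs n :
  finite_set [set w : (nat * nat) * (nat * nat) |
    [/\ w.1.1 <= n, w.1.2 <= n, w.2.1 <= n & w.2.2 <= n]%N].
Proof.
apply: (@sub_finite_set _ _ ((`I_n.+1 `*` `I_n.+1) `*` (`I_n.+1 `*` `I_n.+1))).
  by move=> [[a b] [c d]] /= [].
by apply: finite_setX; apply: finite_setX; exact: finite_II.
Qed.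

(** The quadruple ((d, x), (e, y)) is a solution of d x + e y = n in odd numbers. For even n,
    summing chi(d) chi(e) over the solutions gives the convolution of [chi_sum] with itself over odd
    arguments. *)
Definition odd_quads (n : nat) := [set w : (nat * nat) * (nat * nat) |
  [/\ odd w.1.1, odd w.1.2, odd w.2.1 & odd w.2.2] /\
  (w.1.1 * w.1.2 + w.2.1 * w.2.2 = n)%N].

Definition chi2 (w : (nat * nat) * (nat * nat)) : rat := chi w.1.1 * chi w.2.1.

Lemma finite_odd_quads n : finite_set (odd_quads n).
Proof.
apply: sub_finite_set (finite_nat_pairs n) => -[[d x] [e y]] /=.
move=> [[/= /odd_gt0 h1 /odd_gt0 h2 /odd_gt0 h3 /odd_gt0 h4] h]; split; nia.
Qed.

(* With D = d - e and S = x + y, an element of [odd_quads_gt n] is a solution of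
   e S + x D = n with D, S even and x < S; writing e = t D + c with c < D, the
   involution exchanges (D, c) and (S, x) while keeping the quotient t.  When
   n = 2k with k odd, exactly one of D and S is divisible by 4, so that chi2
   changes sign. *)
Definition dinv (w : (nat * nat) * (nat * nat)) :=
  let: ((d, x), (e, y)) := w in
  let t := (e %/ (d - e))%N in
  ((x + t.+1 * (x + y), e - t * (d - e)), (x + t * (x + y), t.+1 * (d - e) - e))%N.

Definition odd_quads_gt n := odd_quads n `&` [set w | (w.2.1 < w.1.1)%N].

Lemma odd_quads_gtP n d x e y : odd_quads_gt n ((d, x), (e, y)) ->
  exists t D c, [/\ (0 < D)%N, ~~ odd D, (c < D)%N & odd c] /\
  [/\ odd x, odd y, e = t * D + c, d = e + D & (t * D + c) * (x + y) + D * x = n]%N.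
Proof.
move=> [[[/= od ox oe oy] hn] /= ed].
pose D := (d - e)%N; exists (e %/ D)%N, D, (e %% D)%N.
have D0 : (0 < D)%N by rewrite /D; lia.
have oD : ~~ odd D by rewrite /D oddB ?od ?oe // ltnW.
have eE := divn_eq e D.
have oc : odd (e %% D) by move: oe; rewrite {1}eE oddD oddM (negbTE oD) andbF.
rewrite ltn_mod -eE; split=> //; split=> //; first by rewrite /D; lia.
by rewrite -hn -[in RHS](subnKC (ltnW ed)) -/D; ring.
Qed.

Lemma dinvE t D c x y : (0 < D)%N -> (c < D)%N ->
  dinv ((t * D + c + D, x), (t * D + c, y))%N =
  ((x + t.+1 * (x + y), c), (x + t * (x + y), D - c))%N.
Proof.
move=> D0 cD; rewrite /dinv.
have -> : (t * D + c + D - (t * D + c) = D)%N by lia.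
rewrite divnMDl // divn_small // addn0.
congr (((_, _), (_, _))); lia.
Qed.

Lemma dinv_odd_quads_gt n w : odd_quads_gt n w -> odd_quads_gt n (dinv w).
Proof.
case: w => [[d x] [e y]] /odd_quads_gtP[t [D [c [[D0 oD cD oc] [ox oy -> -> h]]]]].
rewrite dinvE //; split; last by rewrite /= mulSn; move: (odd_gt0 ox); lia.
have os : ~~ odd (x + y) by rewrite oddD ox oy.
split; rewrite /=; last first.
  rewrite -h; have -> : (D = c + (D - c))%N by lia.
  by move: (D - c)%N => {h cD D0 oD} {}D; rewrite addKn; ring.
split=> //; rewrite ?oddD ?oddM ?(negbTE os) ?andbF ?addbF ?addFb ?ox ?oy //.
by rewrite oddB ?(ltnW cD) // (negbTE oD) oc.
Qed.

Lemma dinvK n w : odd_quads_gt n w -> dinv (dinv w) = w.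
Proof.
case: w => [[d x] [e y]] /odd_quads_gtP[t [D [c [[D0 oD cD oc] [ox oy -> -> h]]]]].
rewrite dinvE //.
have -> : (x + t.+1 * (x + y) = t * (x + y) + x + (x + y))%N by lia.
rewrite [(x + t * _)%N]addnC dinvE; [|move: (odd_gt0 ox); lia|move: (odd_gt0 oy); lia].
rewrite subnKC ?(ltnW cD) //.
by congr (((_, _), (_, _))); lia.
Qed.

Lemma chi_addn d D : odd d -> ~~ odd D ->
  chi (d + D) * chi d = if (4 %| D)%N then 1 else -1.
Proof.
move=> od oD; rewrite /chi -modnDm /dvdn.
have [->|->] : (d %% 4 = 1 \/ d %% 4 = 3)%N by lia.
  by have [->|->] : (D %% 4 = 0 \/ D %% 4 = 2)%N by lia.
by have [->|->] : (D %% 4 = 0 \/ D %% 4 = 2)%N by lia.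
Qed.

Lemma chi2_dinv k w : odd k -> odd_quads_gt (2 * k) w -> chi2 w = - chi2 (dinv w).
Proof.
move=> ok; case: w => [[d x] [e y]] /odd_quads_gtP[t [D [c [[D0 oD cD oc] [ox oy -> ->
  h]]]]].
rewrite dinvE // /chi2 /=.
have -> : (x + t.+1 * (x + y) = x + t * (x + y) + (x + y))%N by lia.
have os : ~~ odd (x + y) by rewrite oddD ox oy.
rewrite !chi_addn ?oddD ?oddM ?(negbTE os) ?(negbTE oD) ?andbF ?ox ?oc ?oy //.
have oe : odd (t * D + c) by rewrite oddD oddM (negbTE oD) andbF oc.
move: (t * D + c)%N (x + y)%N oe os h => f s of_ os h.
suff : (4 %| D)%N = ~~ (4 %| s)%N by case: (4 %| s)%N => ->; rewrite ?opprK.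
have eD : (D = 2 * D./2)%N by rewrite -[LHS]odd_double_half (negbTE oD) mul2n.
have es : (s = 2 * s./2)%N by rewrite -[LHS]odd_double_half (negbTE os) mul2n.
move: eD es h; move: D./2 s./2 => a b -> ->; rewrite -[4%N]/(2 * 2)%N !dvdn_pmul2l //.
(* Halving gives f b + a x = k with f, x and k odd, so exactly one of a = D / 2 and b = s / 2 is
   even. *)
have -> : (f * (2 * b) + 2 * a * x = 2 * (f * b + a * x))%N by ring.
move=> /eqP; rewrite eqn_pmul2l // => /eqP ekx.
by move: ok; rewrite -ekx oddD !oddM of_ ox andbT /= !dvdn2 negbK;
  case: (odd a) (odd b) => [] [].
Qed.

Lemma sum_odd_quads_gt k : odd k -> \sum_(w \in odd_quads_gt (2 * k)) chi2 w = 0.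
Proof.
move=> ok; set S := \sum_(w \in _) _; suff : S = - S by lra.
rewrite -mulN1r /S mulr_fsumr.
apply: (@fsum_eq _ _ _ _ _ dinv dinv);
  [exact: dinv_odd_quads_gt..|exact: dinvK|exact: dinvK|].
by move=> w hw; rewrite mulN1r; exact: chi2_dinv hw.
Qed.

Lemma cnt_II n : cnt `I_n = n%:R.
Proof. by rewrite /cnt -fsbig_ord sumr_const card_ord. Qed.

(** On the diagonal d = e the weight is chi(d)^2 = 1. From d (x + y) = 2 k with d odd, d divides k,
    and x + y = 2 k / d has k / d solutions in odd numbers; the sum of k / d over d is sigma(k). *)
Lemma sum_odd_quads_eq k : odd k ->
  \sum_(w \in odd_quads (2 * k) `&` [set w | w.1.1 = w.2.1]) chi2 w = (sigma k)%:R.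
Proof.
move=> ok; have k0 := odd_gt0 ok.
have -> : \sum_(w \in odd_quads (2 * k) `&` [set w | w.1.1 = w.2.1]) chi2 w =
    cnt (odd_quads (2 * k) `&` [set w | w.1.1 = w.2.1]).
  apply: eq_fsbigr => -[[d x] [e y]] /set_mem[[[/= od _ _ _] _] /= <-].
  by have := @chi_addn d 0 od isT; rewrite addn0.
rewrite (@cnt_fibers _ _ _ (divisors k) (fun w => w.1.1)).
- rewrite /sigma natr_sum [RHS]sum_divisors_rev //; apply: eq_big_seq => d.
  rewrite -dvdn_divisors // => dk.
  have d0 := dvdn_gt0 k0 dk.
  rewrite -cnt_II; apply/esym.
  move: (divnK dk) ok k0; move: (k %/ d)%N => m <- {dk}; rewrite oddM => /andP[om od] md0.
  apply: (@cnt_eq _ _ _ _ (fun i => ((d, 2 * i + 1), (d, 2 * (m - i).-1 + 1))%N)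
    (fun w => w.1.2./2)).
  + by move=> i /= im; split=> //; split=> //=; split=> //=; [split; lia|nia].
  + move=> [[d1 x] [d2 y]] [[[[/= _ ox _ oy] h] /= e] /= e'].
    have h' : (d * (x + y) = d * (2 * m))%N by move: h; rewrite -e e' => h;
      rewrite mulnDr h /=; ring.
    move/eqP: h'; rewrite eqn_pmul2l // => /eqP; rewrite /=; lia.
  + by move=> i /= im; lia.
  + move=> [[d1 x] [d2 y]] [[[[/= _ ox _ oy] h] /= e] /= e'].
    have h' : (d * (x + y) = d * (2 * m))%N by move: h; rewrite -e e' => h;
      rewrite mulnDr h /=; ring.
    move/eqP: h'; rewrite eqn_pmul2l // => /eqP h'.
    by congr ((_, _), (_, _)); lia.
- by apply: finite_setIl; exact: finite_odd_quads.
- exact: divisors_uniq.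
- move=> [[d x] [e y]] [[[/= od _ _ _] h] /= e']; rewrite -dvdn_divisors //.
  rewrite -(@Gauss_dvdr _ 2) ?coprimen2 // -h -e' -mulnDr; exact: dvdn_mulr.
Qed.

Lemma sum_odd_quads k : odd k -> \sum_(w \in odd_quads (2 * k)) chi2 w = (sigma k)%:R.
Proof.
move=> ok; rewrite -sum_odd_quads_eq //.
rewrite (fsbigID [set w | (w.2.1 < w.1.1)%N]) /=; last exact: finite_odd_quads.
rewrite sum_odd_quads_gt // add0r (fsbigID [set w | w.1.1 = w.2.1]) /=; last first.
  by apply: finite_setIl; exact: finite_odd_quads.
rewrite [X in _ + X](_ : _ = 0) ?addr0.
  congr bigop; congr finite_support; rewrite -setIA; congr (_ `&` _).
  by apply/seteqP; split=> [w []//|w /= e]; split=> //; rewrite e ltnn.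
(* Exchanging (d, x) and (e, y) preserves the weight and carries d < e to d > e. *)
rewrite -[RHS](sum_odd_quads_gt ok).
apply: (@fsum_eq _ _ _ _ _ (fun w => (w.2, w.1)) (fun w => (w.2, w.1))).
- move=> [[d x] [e y]] [[[[/= h1 h2 h3 h4] h] /= h5] /= h6].
  by split; [split=> //=; rewrite addnC|move: h5 h6; rewrite /=; lia].
- move=> [[d x] [e y]] [[[/= h1 h2 h3 h4] h] /= h5].
  by split; [split; [split=> //=; rewrite addnC|rewrite /=; lia]|rewrite /=; lia].
- by case.
- by case.
- by move=> w _; rewrite /chi2 /= mulrC.
Qed.

Lemma sum_factorizations a : (0 < a)%N ->
  \sum_(w \in [set w : nat * nat | (w.1 * w.2 = a)%N]) chi w.1 = chi_sum a.
Proof.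
move=> a0; rewrite /chi_sum [RHS]fsbig_seq ?divisors_uniq //.
apply: (@fsum_eq _ _ _ _ _ (fun w => w.1) (fun d => (d, a %/ d)%N)) => //=.
- by move=> [d x] /= h; rewrite -dvdn_divisors // -h dvdn_mulr.
- by move=> d; rewrite -dvdn_divisors // mulnC => /divnK.
- by move=> [d x] /= h; congr pair; rewrite -h mulKn //; nia.
Qed.

Lemma finite_factorizations a : (0 < a)%N ->
  finite_set [set w : nat * nat | (w.1 * w.2 = a)%N].
Proof.
move=> a0; apply: (@sub_finite_set _ _ (`I_a.+1 `*` `I_a.+1)).
  move=> [x y] /= h; move: a0; rewrite -h muln_gt0 => /andP[x0 y0].
  by split; rewrite /= ltnS ?leq_pmulr ?leq_pmull.
by apply: finite_setX; exact: finite_II.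
Qed.

Lemma sum_odd_chi_sum k : odd k ->
  \sum_(a <- iota 0 (2 * k) | odd a) chi_sum a * chi_sum (2 * k - a) = (sigma k)%:R.
Proof.
move=> ok; rewrite -sum_odd_quads // -big_filter.
rewrite [RHS](@fsum_fibers _ _ _ _ [seq a <- iota 0 (2 * k) | odd a] (fun w =>
  (w.1.1 * w.1.2)%N)).
- apply: eq_big_seq => a; rewrite mem_filter mem_iota add0n => /and3P[oa _ ak].
  have a0 := odd_gt0 oa.
  have b0 : (0 < 2 * k - a)%N by rewrite subn_gt0.
  rewrite -!sum_factorizations // -fsumM; [|exact: finite_factorizations..].
  congr bigop; congr finite_support; apply/seteqP; split.
    move=> [[d x] [e y]] [/= h1 h2]; have ob : odd (2 * k - a) by lia.
    move: oa ob; rewrite -{1}h1 -{1}h2 !oddM => /andP[? ?] /andP[? ?].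
    by split=> //; split=> //=; rewrite h1 h2; lia.
  by move=> [[d x] [e y]] [[_ /= h] /= h']; split=> //=; rewrite -h -h'; lia.
- exact: finite_odd_quads.
- by rewrite filter_uniq ?iota_uniq.
- move=> [[d x] [e y]] [[/= h1 h2 h3 h4] h].
  rewrite mem_filter mem_iota oddM h1 h2 /= add0n -h.
  by rewrite -[X in (X < _)%N]addn0 ltn_add2l muln_gt0 !odd_gt0.
Qed.

End DirichletInvolution.

(** * Sums of four squares *)

Section FourSquares.
Local Open Scope classical_set_scope.
Local Open Scope ring_scope.

Definition S4 n := [set w : gint * gint | (gn w.1 + gn w.2)%N = n].

Lemma finite_S4 n : finite_set (S4 n).
Proof.
apply: (@sub_finite_set _ _ (ball n `*` ball n)); last first.
  by apply: finite_setX; exact: finite_ball.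
by move=> [u v] /= <-; split; rewrite /ball /= ?leq_addr ?leq_addl.
Qed.

Lemma int_sqr_mod4 (x : int) : exists m, x ^+ 2 = 4 * m + (modz x 2).
Proof.
have [e|e] : x = 2 * divz x 2 \/ x = 2 * divz x 2 + 1 by lia.
  by exists (divz x 2 ^+ 2); rewrite {1}e; move: (divz x 2) e => q ->;
    rewrite [modz _ _](_ : _ = 0); [ring|lia].
exists (divz x 2 ^+ 2 + divz x 2); rewrite {1}e; move: (divz x 2) e => q ->.
by rewrite [modz _ _](_ : _ = 1); [ring|lia].
Qed.

Definition S4even n := S4 n `&` [set w | ~~ odd (gn w.1)].
Definition S4odd n := S4 n `&` [set w | odd (gn w.1)].

(** Both norms are odd, and [R2E] contributes a factor 4 for each of them. *)
Lemma cnt_S4odd k : odd k -> cnt (S4odd (2 * k)) = 16%:R * (sigma k)%:R.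
Proof.
move=> ok; rewrite -sum_odd_chi_sum // mulr_sumr.
rewrite (@cnt_fibers _ _ _ [seq a <- iota 0 (2 * k) | odd a] (fun w => gn w.1)).
- rewrite -[RHS]big_filter; apply: eq_big_seq => a; rewrite mem_filter mem_iota add0n =>
  /and3P[oa _ ak].
  have a0 := odd_gt0 oa.
  have b0 : (0 < 2 * k - a)%N by rewrite subn_gt0.
  have -> : S4odd (2 * k) `&` (fun w : gint * gint => gn w.1) @^-1` [set a] =
      S2 a `*` S2 (2 * k - a).
    apply/seteqP; split => [[u v] [[/= h _] /= h']|[u v] [/= h h']].
      by split=> //=; rewrite -h -h' addKn.
    by split=> //; split; rewrite /S4 /= h ?h' ?subnKC // ltnW.
  rewrite cntX; [|exact: finite_S2..].
  by rewrite -/(R2 _) -/(R2 _) !R2E //; ring.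
- by apply: finite_setIl; exact: finite_S4.
- by rewrite filter_uniq ?iota_uniq.
- move=> [u v] [/= h h']; rewrite mem_filter mem_iota h' /= add0n -h -[X in (X < _)%N]addn0.
  rewrite ltn_add2l lt0n; apply/eqP => v0; move: h h'; rewrite /S4 /= v0 addn0 => ->.
  by rewrite oddM.
Qed.

Definition swap23 (w : gint * gint) :=
  (Gint (gre w.1) (gre w.2), Gint (gim w.1) (gim w.2)).
Definition swap24 (w : gint * gint) :=
  (Gint (gre w.1) (gim w.2), Gint (gre w.2) (gim w.1)).

Lemma S4P n (x1 x2 x3 x4 : int) : S4 n (Gint x1 x2, Gint x3 x4) <->
  x1 ^+ 2 + x2 ^+ 2 + (x3 ^+ 2 + x4 ^+ 2) = n%:Z.
Proof.
rewrite /S4 /=; have h1 := gnE (Gint x1 x2); have h2 := gnE (Gint x3 x4).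
rewrite /= in h1 h2; rewrite -h1 -h2; lia.
Qed.

Lemma odd_gn (x y : int) : odd (gn (Gint x y)) = (modz x 2 != modz y 2).
Proof.
have := gnE (Gint x y); have [a /= ->] := int_sqr_mod4 x; have [b ->] := int_sqr_mod4 y.
lia.
Qed.

(* Since the squares add up to 2 mod 4, exactly two of the four coordinates are
   odd; exchanging coordinates shows that the solutions with x1 and x2 of
   different parity are twice as many as the others. *)
Lemma cnt_S4 k : odd k -> cnt (S4 (2 * k)) = 24%:R * (sigma k)%:R.
Proof.
move=> ok; have f4 := finite_S4 (2 * k).
have E0 : cnt (S4 (2 * k)) = cnt (S4odd (2 * k)) + cnt (S4even (2 * k)).
  rewrite (cntID [set w | odd (gn w.1)]) //; congr (_ + cnt _).
  by apply/seteqP; split=> [w [h1 h2]|w [h1 h2]]; split=> //; apply/negP.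
pose A := [set w : gint * gint | modz (gre w.1) 2 = modz (gre w.2) 2].
have E1 : cnt (S4odd (2 * k) `&` A) = cnt (S4even (2 * k)).
  apply: (@cnt_eq _ _ _ _ swap23 swap23) =>
    [[[a b] [c d]]|[[a b] [c d]]|[[a b] [c d]]|[[a b] [c d]]] //.
    rewrite /S4odd /S4even /A /swap23 /= => -[[/S4P h /=]]; rewrite odd_gn => h1 /= h2.
    by split; [apply/S4P; lia|rewrite /= odd_gn; lia].
  rewrite /S4odd /S4even /A /swap23 /= => -[/S4P h /=]; rewrite odd_gn => h1.
  have hs : modz a 2 != modz c 2.
    move: h; have [m1 ->] := int_sqr_mod4 a; have [m2 ->] := int_sqr_mod4 b.
    have [m3 ->] := int_sqr_mod4 c; have [m4 ->] := int_sqr_mod4 d.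
    lia.
  split; [split; [apply/S4P; lia|rewrite /= odd_gn; lia]|rewrite /=].
  move: h; have [m1 ->] := int_sqr_mod4 a; have [m2 ->] := int_sqr_mod4 b.
  have [m3 ->] := int_sqr_mod4 c; have [m4 ->] := int_sqr_mod4 d.
  lia.
have E2 : cnt (S4odd (2 * k) `&` ~` A) = cnt (S4even (2 * k)).
  apply: (@cnt_eq _ _ _ _ swap24 swap24) =>
    [[[a b] [c d]]|[[a b] [c d]]|[[a b] [c d]]|[[a b] [c d]]] //.
    rewrite /S4odd /S4even /A /swap24 /= => -[[/S4P h /=]]; rewrite odd_gn => h1 /= h2.
    split; [apply/S4P; lia|rewrite /= odd_gn].
    move: h; have [m1 ->] := int_sqr_mod4 a; have [m2 ->] := int_sqr_mod4 b.
    have [m3 ->] := int_sqr_mod4 c; have [m4 ->] := int_sqr_mod4 d.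
    lia.
  rewrite /S4odd /S4even /A /swap24 /= => -[/S4P h /=]; rewrite odd_gn => h1.
  have [hs1 hs2] : modz a 2 != modz d 2 /\ modz a 2 != modz c 2.
    move: h; have [m1 ->] := int_sqr_mod4 a; have [m2 ->] := int_sqr_mod4 b.
    have [m3 ->] := int_sqr_mod4 c; have [m4 ->] := int_sqr_mod4 d.
    lia.
  by split; [split; [apply/S4P; lia|rewrite /= odd_gn; lia]|rewrite /=; lia].
have := cntID A (finite_setIl [set w | odd (gn w.1)] f4).
rewrite -/(S4odd _) E1 E2 cnt_S4odd // => E3.
rewrite E0 cnt_S4odd //; lra.
Qed.

End FourSquares.

(** * Almost coprime pairs of Gaussian integers *)

Section CoprimePairs.
Local Open Scope classical_set_scope.
Local Open Scope ring_scope.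
Implicit Types x y z u v a b d e : gint.

Lemma gdvd_1i z : ~~ odd (gn z) -> gdvd (Gint 1 1) z.
Proof.
case: z => x y; rewrite odd_gn negbK => /eqP xy.
by exists (Gint (divz (x + y) 2) (divz (y - x) 2)); apply: gintP; rewrite gmulE /=; lia.
Qed.

Lemma odd_gnB x y : odd (gn (x - y)) = odd (gn x + gn y).
Proof.
case: x y => [a b] [c d].
rewrite oddD (_ : _ - _ = Gint (a - c) (b - d)) // !odd_gn; lia.
Qed.

Lemma gmul_conj_cancel x y : gn x = 1%N -> gconj x * (x * y) = y.
Proof. by move=> x1; rewrite mulrA [gconj x * x]mulrC gunit_inv // mul1r. Qed.

Lemma gn_odd_mod4 z : odd (gn z) -> (gn z = 1 %[mod 4])%N.
Proof.
case: z => x y; rewrite odd_gn => xy; have := gnE (Gint x y) => /=.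
by have [a ->] := int_sqr_mod4 x; have [b ->] := int_sqr_mod4 y; lia.
Qed.

(* The greatest common divisor of u and v divides 2. *)
Definition cop u v := exists a b, a * u + b * v = gnat 2.

Lemma cop_unit x u v : gn x = 1%N -> cop u v -> cop (x * u) (x * v).
Proof.
move=> x1 [a [b ab]]; exists (a * gconj x), (b * gconj x).
by rewrite -!mulrA !gmul_conj_cancel.
Qed.

Lemma gn_1i : gn (Gint 1 1) = 2%N. Proof. by []. Qed.

(** Since (1 - i)(1 + i) = 2, [cop] still admits a common factor 1 + i. *)
Lemma cop_1i a b u v : a * u + b * v = 1 -> cop (Gint 1 1 * u) (Gint 1 1 * v).
Proof.
move=> ab; exists (Gint 1 (-1) * a), (Gint 1 (-1) * b).
transitivity (Gint 1 (-1) * Gint 1 1 * (a * u + b * v)); first by ring.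
by rewrite ab mulr1; apply: gintP.
Qed.

Lemma cop_1 a b u v : a * u + b * v = 1 -> cop u v.
Proof.
move=> ab; exists (gnat 2 * a), (gnat 2 * b).
by rewrite -!mulrA -mulrDr ab mulr1.
Qed.

Definition Prim k := [set w : gint * gint | (gn w.1 + gn w.2 = 2 * k)%N /\ cop w.1 w.2].
Definition num_prim k : rat := cnt (Prim k).

Lemma finite_Prim k : finite_set (Prim k).
Proof. by apply: sub_finite_set (finite_S4 (2 * k)) => w []. Qed.

(** With gn d = 2 m + 1, z = z (gn d) - m (2 z), and d divides both terms. *)
Lemma odd_gdvd_half d z : odd (gn d) -> gdvd d (gnat 2 * z) -> gdvd d z.
Proof.
move=> od [w hw]; exists (z * gconj d - w * gnat (gn d)./2).
have -> : (z * gconj d - w * gnat (gn d)./2) * d =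
  z * (d * gconj d) - (w * d) * gnat (gn d)./2 by ring.
rewrite mul_conj -hw -{1}(odd_double_half (gn d)) od -mul2n.
have -> : gnat (true + 2 * (gn d)./2) = 1 + gnat 2 * gnat (gn d)./2.
  by rewrite -gnatM; apply: gintP.
by ring.
Qed.

Lemma cop_scale_dvd x y u v u' v' : odd (gn x) -> cop u' v' ->
  x * u = y * u' -> x * v = y * v' -> gdvd x y.
Proof.
move=> ox [a [b ab]] hu hv; apply: odd_gdvd_half => //.
exists (a * u + b * v); rewrite -ab.
transitivity (a * (y * u') + b * (y * v')); first by ring.
by rewrite -hu -hv; ring.
Qed.

Lemma cop_scaleP x y u v u' v' : odd (gn x) -> odd (gn y) -> cop u v -> cop u' v' ->
  x * u = y * u' -> x * v = y * v' ->
  exists e, [/\ gn e = 1%N, x = e * y, u = gconj e * u' & v = gconj e * v'].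
Proof.
move=> ox oy c c' hu hv.
have [f hf] := cop_scale_dvd ox c' hu hv.
have [e he] := cop_scale_dvd oy c (esym hu) (esym hv).
have x0 : x != 0 by rewrite -gn_gt0 odd_gt0.
have y0 : y != 0 by rewrite -gn_gt0 odd_gt0.
have e1 : gn e = 1%N.
  have /(congr1 gn) : e * f = 1.
    by apply: (gmulI x0); rewrite mulr1 {2}he {1}hf mulrC; ring.
  by rewrite gnM => /eqP; rewrite muln_eq1 => /andP[/eqP].
exists e; split=> //.
  by apply: (gmulI x0); rewrite hu {1}he; transitivity (y * (gconj e * (e * u')));
    [rewrite gmul_conj_cancel|ring].
by apply: (gmulI x0); rewrite hv {1}he; transitivity (y * (gconj e * (e * v')));
  [rewrite gmul_conj_cancel|ring].
Qed.

(** Triples (c, u, v) split an odd common factor c off the pair (c u, c v); they link all pairs of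
    total norm 2 k with the pairs in [Prim]. *)
Definition scale_dom k := [set t : gint * (gint * gint) |
  [/\ (gn t.1 * (gn t.2.1 + gn t.2.2) = 2 * k)%N, odd (gn t.1) & cop t.2.1 t.2.2]].

Definition scale (t : gint * (gint * gint)) := (t.1 * t.2.1, t.1 * t.2.2).

Lemma finite_scale_dom k : (0 < k)%N -> finite_set (scale_dom k).
Proof.
move=> k0; apply: (@sub_finite_set _ _ (ball (2 * k) `*` (ball (2 * k) `*` ball (2 * k)))).
  move=> [x [u v]] [/= h ox _]; have x0 := odd_gt0 ox.
  have : (0 < gn x * (gn u + gn v))%N by rewrite h; lia.
  rewrite muln_gt0 => /andP[_ s0].
  have h1 := leq_pmulr (gn x) s0; have h2 := leq_pmull (gn u + gn v) x0.
  by split; [|split]; rewrite /ball /=; lia.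
by apply: finite_setX; [|apply: finite_setX]; exact: finite_ball.
Qed.

Lemma scale_surj k u v : odd k -> S4 (2 * k) (u, v) -> exists t, scale_dom k t /\ scale t
  = (u, v).
Proof.
rewrite /S4 /= => ok huv; have k0 := odd_gt0 ok.
have [d [a [b [hd [e he] [f hf]]]]] := gbezout u v.
have d0 : d != 0.
  by rewrite -gn_gt0 lt0n; apply/eqP => d0; move: huv; rewrite he hf !gnM d0; lia.
have ef : a * e + b * f = 1.
  by apply: (gmulI d0); rewrite mulr1 {2}hd he hf; ring.
move: huv; rewrite he hf !gnM => huv.
have [od|od] := boolP (odd (gn d)).
  exists (d, (e, f)); rewrite /scale /= ![d * _]mulrC; split=> //; split=> //=; first lia.
  exact: cop_1 ef.
(* A gcd of even norm leaves one factor 1 + i to the pair; then gn c (gn e + gn f) = k is odd, so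
   the remaining factor c has odd norm. *)
case: (gdvd_1i od) => c hc.
exists (c, (Gint 1 1 * e, Gint 1 1 * f)); rewrite /scale /=; split; last first.
  by rewrite hc; congr pair; ring.
move: huv; rewrite hc gnM gn_1i => huv.
have e2 : (gn c * (gn e + gn f) = k)%N by lia.
split; [rewrite /= !gnM gn_1i; lia| |exact: cop_1i ef].
by move: ok; rewrite -e2 oddM => /andP[].
Qed.

Lemma cnt_scale_fiber k w : odd k -> S4 (2 * k) w ->
  cnt (scale_dom k `&` scale @^-1` [set w]) = 4%:R.
Proof.
case: w => u v ok /(scale_surj ok)[[c [u0 v0]] [[/= h0 oc cp] [hu hv]]].
rewrite -R2_1; apply/esym.
apply: (@cnt_bij _ _ _ _ (fun e => (e * c, (gconj e * u0, gconj e * v0)))).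
have c0 : c != 0 by rewrite -gn_gt0 odd_gt0.
split.
- move=> e e1; split; first split; rewrite /= ?gnM ?gn_conj ?e1 ?mul1n //.
    by apply: cop_unit => //; rewrite gn_conj.
  rewrite /scale /= -hu -hv; congr pair.
    by rewrite -[RHS](gmul_conj_cancel _ e1); ring.
  by rewrite -[RHS](gmul_conj_cancel _ e1); ring.
- by move=> e e' _ _ /(congr1 fst) /= h; apply: (gmulI c0); rewrite mulrC h mulrC.
- move=> [x [u1 v1]] [[/= h1 ox cp1] [hu1 hv1]].
  have [] := @cop_scaleP x c u1 v1 u0 v0; rewrite ?hu1 ?hv1 //.
  by move=> e [e1 -> -> ->]; exists e.
Qed.

(** Double counting of [scale_dom k]: by the fibres of [scale], 4 points over each of the 24
    sigma(k) elements of [S4 (2 * k)], and by the norm of the split factor. *)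
Lemma sum_R2_num_prim k : odd k ->
  \sum_(d <- divisors k) R2 d * num_prim (k %/ d) = 96%:R * (sigma k)%:R.
Proof.
move=> ok; have k0 := odd_gt0 ok.
have <- : cnt (scale_dom k) = 96%:R * (sigma k)%:R.
  rewrite (@cnt_fibers_const _ _ (scale_dom k) (S4 (2 * k)) scale 4%:R).
  - by rewrite cnt_S4 //; ring.
  - exact: finite_scale_dom.
  - exact: finite_S4.
  - by move=> [x [u v]] [/= h _ _]; rewrite /S4 /= !gnM -mulnDr.
  - by move=> w; exact: cnt_scale_fiber.
rewrite (@cnt_fibers _ _ _ (divisors k) (fun t => gn t.1)).
- apply: eq_big_seq => d; rewrite -dvdn_divisors // => dk.
  have d0 := dvdn_gt0 k0 dk.
  rewrite /R2 /num_prim -cntX; [|exact: finite_S2|exact: finite_Prim]; congr cnt.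
  apply/seteqP; split=> [[x [u v]] [hx [huv cp]]|[x [u v]] [[/= h ox cp] hx]].
    rewrite /S2 /= in hx; split=> //; split; rewrite //= hx.
      by rewrite /= in huv; rewrite huv mulnCA [(d * _)%N]mulnC divnK.
    by move: ok; rewrite -(divnK dk) oddM => /andP[].
  split=> //; split=> //=; apply/eqP; rewrite -(eqn_pmul2l d0).
  by rewrite /= in hx; rewrite -{1}hx h mulnCA [(d * _)%N]mulnC divnK.
- exact: finite_scale_dom.
- exact: divisors_uniq.
- move=> [x [u v]] [/= h ox _]; rewrite -dvdn_divisors //.
  by rewrite -(@Gauss_dvdr _ 2) ?coprimen2 // -h dvdn_mulr.
Qed.

End CoprimePairs.

(** * Parametrization of isotropic vectors *)

Section IsotropicVectors.
Local Open Scope classical_set_scope.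
Local Open Scope ring_scope.
Implicit Types x y z u v a b d e : gint.

(** A - B = 2 i z2, so the congruence expresses that z1 and z2 are Gaussian integers. Moreover |A|^2
    + |B|^2 + 2 |C|^2 = 2 |z|^2 = 2 (N(theta) + N(eta)), which is the 4 M. *)
Definition isotropic M := [set t : gint * (gint * gint) |
  [/\ t.1 * t.2.1 = t.2.2 * t.2.2, gdvd (gnat 2) (t.1 - t.2.1) &
    (gn t.1 + gn t.2.1 + 2 * gn t.2.2 = 4 * M)%N]].

Definition param (t : gint * (gint * gint)) :=
  (t.1 * t.2.1 * t.2.1, (t.1 * t.2.2 * t.2.2, t.1 * t.2.1 * t.2.2)).

(* [M] is the norm of the twin pair attached to (h, u, v). *)
Definition param_dom M := [set t : gint * (gint * gint) | exists k,
  [/\ odd k, (gn t.1 * k ^ 2 = M)%N, (gn t.2.1 + gn t.2.2 = 2 * k)%N & cop t.2.1 t.2.2]].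

Lemma finite_isotropic M : finite_set (isotropic M).
Proof.
apply: (@sub_finite_set _ _ (ball (4 * M) `*` (ball (4 * M) `*` ball (4 * M)))).
  by move=> [x [u v]] [/= _ _ h]; split; [|split]; rewrite /ball /=; lia.
by apply: finite_setX; [|apply: finite_setX]; exact: finite_ball.
Qed.

Lemma finite_param_dom M : (0 < M)%N -> finite_set (param_dom M).
Proof.
move=> M0; apply: (@sub_finite_set _ _ (ball M `*` (ball (2 * M) `*` ball (2 * M)))).
  move=> [x [u v]] [k [/= ok h h' _]]; have k0 := odd_gt0 ok.
  have x0 : (0 < gn x)%N by move: M0; rewrite -h muln_gt0 => /andP[].
  have k2 : (0 < k ^ 2)%N by rewrite expn_gt0 k0.
  have h1 := leq_pmulr (gn x) k2; have h2 := leq_pmull (k ^ 2) x0.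
  have h3 : (k <= k ^ 2)%N by rewrite -{1}[k]expn1 leq_pexp2l.
  by split; [|split]; rewrite /ball /=; lia.
by apply: finite_setX; [|apply: finite_setX]; exact: finite_ball.
Qed.

Lemma param_isotropic M t : param_dom M t -> isotropic M (param t).
Proof.
case: t => h [u v] [k [/= ok hM huv cp]]; split=> /=.
- by ring.
- have ouv : ~~ odd (gn (u - v)) by rewrite odd_gnB huv oddM.
  case: (gdvd_1i ouv) => w hw.
  (* From u - v = w (1 + i) and u + v = (u - v) + 2 v, both factors of u^2 - v^2 are divisible by 1
     + i, and (1 + i)^2 = 2 i. *)
  exists (h * w * Gint 0 1 * (w + Gint 1 (-1) * v)).
  have -> : h * u * u - h * v * v = h * (u - v) * ((u - v) + 2%:R * v) by ring.
  rewrite hw.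
  have -> : 2%:R = Gint 1 1 * Gint 1 (-1) :> gint by apply: gintP.
  have -> : gnat 2 = Gint 1 1 * Gint 1 1 * Gint 0 (-1) by apply: gintP.
  have e1 : Gint 0 1 * Gint 0 (-1) = 1 by apply: gintP.
  transitivity (h * w * (w + Gint 1 (-1) * v) * Gint 1 1 * Gint 1 1 * 1); first by ring.
  by rewrite -e1; ring.
- rewrite !gnM -hM.
  transitivity (gn h * (gn u + gn v) ^ 2)%N; first by ring.
  by rewrite huv; ring.
Qed.

(* If A = u d and C = v d with a u + b v = 1, then u B = v^2 d, whence u | d. *)
Lemma isotropic_factor A B C : A * B = C * C -> ~ (A = 0 /\ B = 0) ->
  exists e u v, [/\ A = e * u * u, B = e * v * v, C = e * u * v &
    exists a b, a * u + b * v = 1].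
Proof.
move=> ABC nz; have [A0|A0] := eqVneq A 0.
  have C0 : C = 0 by move: ABC; rewrite A0 mul0r => /esym/gmul_eq0 [].
  exists B, 0, 1; rewrite A0 C0 !mulr0 !mulr1; split=> //.
  by exists 0, 1; rewrite mul0r add0r mulr1.
have [d [a [b [hd [u hu] [v hv]]]]] := gbezout A C.
have d0 : d != 0 by apply/eqP => d0; move/eqP: A0; rewrite hu d0 mulr0.
have uv1 : a * u + b * v = 1.
  by apply: (gmulI d0); rewrite mulr1 {2}hd hu hv; ring.
have u0 : u != 0 by apply/eqP => u0; move/eqP: A0; rewrite hu u0 mul0r.
have uB : u * B = v * v * d.
  apply: (gmulI d0); transitivity (A * B); first by rewrite hu; ring.
  by rewrite ABC hv; ring.
pose e := a * a * u * d + 2%:R * a * b * v * d + b * b * B.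
have de : d = u * e.
  transitivity (d * (a * u + b * v) * (a * u + b * v)); first by rewrite uv1 !mulr1.
  transitivity (u * (a * a * u * d + 2%:R * a * b * v * d) + b * b * (v * v * d));
    first by ring.
  by rewrite -uB /e; ring.
exists e, u, v; split.
- by rewrite hu de; ring.
- by apply: (gmulI u0); rewrite uB de; ring.
- by rewrite hv de; ring.
- by exists a, b.
Qed.

Lemma param_surj M t : (0 < M)%N -> isotropic M t -> exists s, param_dom M s /\ param s = t.
Proof.
case: t => A [B C] M0 [/= ABC dAB hM].
have nz : ~ (A = 0 /\ B = 0).
  move=> [A0 B0]; have C0 : C = 0 by move: ABC; rewrite A0 mul0r => /esym/gmul_eq0 [].
  by move: hM; rewrite A0 B0 C0 gn0; lia.
have [e [u [v [hA hB hC [a [b ab]]]]]] := isotropic_factor ABC nz.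
have hN : (gn e * (gn u + gn v) ^ 2 = 4 * M)%N.
  by rewrite -hM hA hB hC !gnM; ring.
have [oN|eN] := boolP (odd (gn u + gn v)); last first.
  pose k := (gn u + gn v)./2.
  have kE : (gn u + gn v = 2 * k)%N by rewrite /k -[LHS]odd_double_half (negbTE eN) mul2n.
  have eM : (gn e * k ^ 2 = M)%N.
    apply/eqP; rewrite -(@eqn_pmul2l 4) // -hN kE; apply/eqP; ring.
  exists (e, (u, v)); split; last by rewrite /param /= -hA -hB -hC.
  exists k; split=> //; last exact: cop_1 ab.
  have [ou|eu] := boolP (odd (gn u)).
    have ov : odd (gn v) by move: eN; rewrite oddD ou; case: (odd (gn v)).
    by have := gn_odd_mod4 ou; have := gn_odd_mod4 ov; lia.
  have ev : ~~ odd (gn v) by move: eN; rewrite oddD (negbTE eu).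
  have : gdvd (Gint 1 1) 1.
    by rewrite -ab; apply: gdvd_add; apply: gdvd_mull; exact: gdvd_1i.
  by move/gdvd_gn.
(* Here u^2 - v^2 has odd norm, so 2 | A - B = e (u^2 - v^2) forces 2 | e. As 2 = -i (1 + i)^2, this
   factor moves into u and v as 1 + i each, and k is gn u + gn v itself. *)
have oB : odd (gn (u * u - v * v)).
  have -> : u * u - v * v = (u - v) * (u - - v) by ring.
  have ovN : gn (- v) = gn v by rewrite /gn /= !abszN.
  by rewrite gnM oddM !odd_gnB ovN oN.
have [f hf] : gdvd (gnat 2) e.
  have := oB; set z := u * u - v * v; rewrite -(gn_conj z) => oz.
  case: dAB => w hw.
  have : gdvd (gnat 2) (gnat (gn z) * e).
    exists (w * gconj z); rewrite -mul_conj.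
    transitivity (gconj z * (A - B)); first by rewrite hA hB /z; ring.
    by rewrite hw; ring.
  case=> y hy; exists (y - gnat (gn z)./2 * e).
  have -> : (y - gnat (gn z)./2 * e) * gnat 2 = y * gnat 2 - gnat 2 * gnat (gn z)./2 * e
    by ring.
  rewrite -hy -gnatM; move: oz; rewrite gn_conj => oz.
  rewrite -{1}(odd_double_half (gn z)) oz -mul2n.
  have -> : gnat (true + 2 * (gn z)./2) = 1 + gnat (2 * (gn z)./2).
    by apply: gintP.
  by ring.
have ipp : gnat 2 = Gint 0 (-1) * Gint 1 1 * Gint 1 1 by apply: gintP.
exists (Gint 0 (-1) * f, (Gint 1 1 * u, Gint 1 1 * v)); split.
  exists (gn u + gn v)%N; split=> //=.
  - rewrite gnM (_ : gn (Gint 0 (-1)) = 1%N) // mul1n.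
    apply/eqP; rewrite -(@eqn_pmul2l 4) // -hN hf gnM gn_nat; apply/eqP; ring.
  - by rewrite !gnM gn_1i mulnDr.
  - exact: cop_1i ab.
by rewrite /param /= hA hB hC hf ipp; congr (_, (_, _)); ring.
Qed.

Lemma gn_eq4 z : gn z = 4%N -> exists e, gn e = 1%N /\ z = gnat 2 * e.
Proof.
move=> z4; have [w hw] : gdvd (Gint 1 1) z by apply: gdvd_1i; rewrite z4.
have w2 : gn w = 2%N by move: z4; rewrite hw gnM gn_1i; lia.
have [e he] : gdvd (Gint 1 1) w by apply: gdvd_1i; rewrite w2.
have e1 : gn e = 1%N by move: w2; rewrite he gnM gn_1i; lia.
exists (Gint 0 1 * e); split; first by rewrite gnM e1.
rewrite hw he; have -> : gnat 2 = Gint 1 1 * Gint 1 1 * Gint 0 (-1) by apply: gintP.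
have e2 : Gint 0 (-1) * Gint 0 1 = 1 by apply: gintP.
transitivity (e * Gint 1 1 * Gint 1 1 * 1); first by ring.
by rewrite -e2; ring.
Qed.

Lemma param_ratio M s t : (0 < M)%N -> param_dom M s -> param_dom M t -> param s = param
  t ->
  s.2.1 * t.2.2 = t.2.1 * s.2.2.
Proof.
case: s t => h [u v] [h0 [u0 v0]] M0 [k [/= ok hM _ _]] [k0 [/= ok0 hM0 _ _]].
move=> e; have /= eA := congr1 fst e; have /= eC := congr1 (fun t => t.2.2) e.
have hn0 : h != 0 by apply/eqP => h00; move: M0; rewrite -hM h00.
have h0n0 : h0 != 0 by apply/eqP => h00; move: M0; rewrite -hM0 h00.
have [u00|un0] := eqVneq u 0.
  have : h0 * u0 * u0 = 0 by rewrite -eA u00 mulr0.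
  by move/gmul_eq0 => [/gmul_eq0[/eqP|]|] => [|->|->]; rewrite ?(negbTE h0n0) // u00 !mul0r.
have An0 : h * u * u != 0.
  by apply/eqP => /gmul_eq0[/gmul_eq0[]|] /eqP; apply/negP.
apply: (gmulI An0); transitivity (u * u0 * (h * u * v)); last by ring.
by rewrite eA eC; ring.
Qed.

(** The pairs are proportional, and the relation a0 u0 + b0 v0 = 2 turns this into 2 (u, v) = s (u0,
    v0) with 4 k = gn s * k0; symmetrically 4 k0 = gn s' * k. As k and k0 are odd, 4 divides both
    norms, so k and k0 divide each other, gn s = 4 and s is 2 times a unit. The value of h then
    follows from A or B. *)
Lemma paramP M s t : (0 < M)%N -> param_dom M s -> param_dom M t -> param s = param t ->
  exists e, gn e = 1%N /\ s = (e * e * t.1, (gconj e * t.2.1, gconj e * t.2.2)).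
Proof.
move=> M0 Ys Yt st; have := param_ratio M0 Ys Yt st.
case: s t Ys Yt st => h [u v] [h0 [u0 v0]] /=.
move=> [k [/= ok hM huv [a [b ab]]]] [k0 [/= ok0 hM0 huv0 [a0 [b0 ab0]]]] st uv.
pose s := a0 * u + b0 * v; pose s' := a * u0 + b * v0.
have su : gnat 2 * u = s * u0.
  by rewrite -ab0 mulrDl -!mulrA [v0 * u]mulrC uv /s; ring.
have sv : gnat 2 * v = s * v0.
  by rewrite -ab0 mulrDl -!mulrA -uv /s; ring.
have su' : gnat 2 * u0 = s' * u.
  by rewrite -ab mulrDl -!mulrA [v * u0]mulrC -uv /s'; ring.
have sv' : gnat 2 * v0 = s' * v.
  by rewrite -ab mulrDl -!mulrA uv /s'; ring.
have n1 : (4 * k = gn s * k0)%N.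
  have := congr1 gn su; have := congr1 gn sv; rewrite !gnM gn_nat; nia.
have n2 : (4 * k0 = gn s' * k)%N.
  have := congr1 gn su'; have := congr1 gn sv'; rewrite !gnM gn_nat; nia.
have k_gt0 := odd_gt0 ok; have k0_gt0 := odd_gt0 ok0.
have d1 : (4 %| gn s)%N.
  rewrite -(@Gauss_dvdl _ _ k0) -?n1 ?dvdn_mulr //.
  by rewrite (coprimeXl 2 (_ : coprime 2 k0)) // coprime2n.
have d2 : (4 %| gn s')%N.
  rewrite -(@Gauss_dvdl _ _ k) -?n2 ?dvdn_mulr //.
  by rewrite (coprimeXl 2 (_ : coprime 2 k)) // coprime2n.
have s4 : gn s = 4%N.
  case/dvdnP: d1 d2 => m1 m1E /dvdnP[m2 m2E].
  have kk : (k = m1 * k0)%N by move: n1; rewrite m1E; lia.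
  have kk0 : (k0 = m2 * k)%N by move: n2; rewrite m2E; lia.
  have : (m1 * m2 == 1)%N.
    by rewrite -(eqn_pmul2r k_gt0) mul1n -mulnA -kk0 -kk.
  by rewrite muln_eq1 m1E => /andP[/eqP->].
have [e [e1 se]] := gn_eq4 s4.
have g2 : gnat 2 != 0 by [].
have ue : u = e * u0 by apply: (gmulI g2); rewrite su se mulrA.
have ve : v = e * v0 by apply: (gmulI g2); rewrite sv se mulrA.
exists (gconj e); rewrite gn_conj e1 gconjK; split=> //.
rewrite -ue -ve; congr (_, (_, _)).
have /= eA := congr1 fst st; have /= eB := congr1 (fun t => t.2.1) st.
have ce : gconj e * gconj e * (e * e) = 1.
  by transitivity ((e * gconj e) * (e * gconj e)); [ring|rewrite gunit_inv ?mulr1].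
have [u00|un0] := eqVneq u0 0.
  have vn0 : v0 != 0.
    by apply/eqP => v00; move: huv0; rewrite u00 v00 gn0; lia.
  have vvn0 : v0 * v0 != 0 by apply/eqP => /gmul_eq0[] /eqP; apply/negP.
  apply: (gmulI vvn0); transitivity (gconj e * gconj e * (h0 * v0 * v0)); last by ring.
  rewrite -eB ve; transitivity (v0 * v0 * h * (gconj e * gconj e * (e * e))); last by ring.
  by rewrite ce; ring.
have uun0 : u0 * u0 != 0 by apply/eqP => /gmul_eq0[] /eqP; apply/negP.
apply: (gmulI uun0); transitivity (gconj e * gconj e * (h0 * u0 * u0)); last by ring.
rewrite -eA ue; transitivity (u0 * u0 * h * (gconj e * gconj e * (e * e))); last by ring.
by rewrite ce; ring.
Qed.

Lemma cnt_param_fiber M t : (0 < M)%N -> isotropic M t ->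
  cnt (param_dom M `&` param @^-1` [set t]) = 4%:R.
Proof.
move=> M0 /(param_surj M0)[[h [u v]] [Yh <-]].
rewrite -R2_1; apply/esym.
apply: (@cnt_bij _ _ _ _ (fun e => (e * e * h, (gconj e * u, gconj e * v)))).
case: (Yh) => k [/= ok hM huv cp].
split.
- move=> e e1; have ce : e * e * (gconj e * gconj e) = 1.
    by transitivity ((e * gconj e) * (e * gconj e)); [ring|rewrite gunit_inv ?mulr1].
  split; first exists k; last first.
    rewrite /param /=; congr (_, (_, _)).
    + by transitivity (e * e * (gconj e * gconj e) * (h * u * u)); [ring|rewrite ce mul1r].
    + by transitivity (e * e * (gconj e * gconj e) * (h * v * v)); [ring|rewrite ce mul1r].
    + by transitivity (e * e * (gconj e * gconj e) * (h * u * v)); [ring|rewrite ce mul1r].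
  split; rewrite //= ?gnM ?gn_conj ?e1 ?mul1n //.
  by apply: cop_unit => //; rewrite gn_conj.
(* The factor e^2 on h does not separate e from -e; the action on (u, v), which is nonzero, does. *)
- move=> e e' _ _ ee'.
  have /= e2 := congr1 (fun t => t.2.1) ee'; have /= e3 := congr1 (fun t => t.2.2) ee'.
  rewrite -[e]gconjK -[e']gconjK; congr gconj.
  have [u0|un0] := eqVneq u 0; last by apply: (gmulI un0); rewrite ![u * _]mulrC.
  have vn0 : v != 0.
    by apply/eqP => v0; move: huv; rewrite u0 v0 gn0; have := odd_gt0 ok; lia.
  by apply: (gmulI vn0); rewrite ![v * _]mulrC.
- move=> s [Ys ps]; have [e [e1 ->]] := paramP M0 Ys Yh ps.
  by exists e.
Qed.

Lemma cnt_param_dom M : (0 < M)%N ->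
  cnt (param_dom M) = \sum_(k <- divisors M | odd k && (k ^ 2 %| M)%N) R2 (M %/ k ^ 2) *
    num_prim k.
Proof.
move=> M0; rewrite -big_filter.
rewrite (@cnt_fibers _ _ _ [seq k <- divisors M | odd k && (k ^ 2 %| M)%N]
   (fun t => (gn t.2.1 + gn t.2.2)./2)).
- apply: eq_big_seq => k; rewrite mem_filter => /andP[/andP[ok kM] _].
  have k0 : (0 < k ^ 2)%N by rewrite expn_gt0 odd_gt0.
  rewrite /R2 /num_prim -cntX; [|exact: finite_S2|exact: finite_Prim]; congr cnt.
  apply/seteqP; split=> [[h [u v]] [[k' [/= ok' hM huv cp]] /= hk]|[h [u v]] [/= h1 [/=
    h2 cp]]].
    have kk : k' = k by rewrite -hk huv; lia.
    by subst k'; split=> //; rewrite /S2 /= -hM mulnK.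
  split; last by rewrite /= h2; lia.
  by exists k; split=> //=; rewrite h1 divnK.
- exact: finite_param_dom.
- by rewrite filter_uniq ?divisors_uniq.
- move=> [h [u v]] [k [/= ok hM huv _]].
  rewrite mem_filter huv (_ : (2 * k)./2 = k); last by lia.
  rewrite ok -dvdn_divisors // -hM dvdn_mull //=.
  by rewrite -mulnn mulnA dvdn_mull.
Qed.

End IsotropicVectors.

(** * Twin pairs as isotropic vectors *)

Section TwinsAsIsotropic.
Local Open Scope classical_set_scope.
Local Open Scope ring_scope.

Definition row3 (a b c : int) : 'rV[int]_3 := \row_j [:: a; b; c]`_j.

Lemma row3E (u : 'rV[int]_3) : u = row3 (u 0 0) (u 0 1) (u 0 2%:R).
Proof.
apply/rowP => j; rewrite mxE.
by case: j => [[|[|[|//]]] hj] /=; congr (u _ _); apply: val_inj.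
Qed.

Lemma dotv_row3 a b c a' b' c' :
  dotv (row3 a b c) (row3 a' b' c') = a * a' + b * b' + c * c'.
Proof. by rewrite /dotv !big_ord_recl big_ord0 !mxE /= addr0 addrA. Qed.

Lemma twin_pairs_row3 M a b c a' b' c' : (0 < M)%N ->
  twin_pairs M (row3 a b c, row3 a' b' c') <->
  [/\ a * a' + b * b' + c * c' = 0, a * a + b * b + c * c = M%:Z &
    a' * a' + b' * b' + c' * c' = M%:Z].
Proof.
move=> M0; rewrite /twin_pairs /twins /normv /= !dotv_row3; split.
  by move=> [[_ _ -> _] -> ->].
move=> [h1 h2 h3]; split=> //; split=> //; last by rewrite h2 h3.
  apply/eqP => r0; have := dotv_row3 a b c a b c; rewrite h2 r0.
  by rewrite /dotv big1 => [|i _]; [lia|rewrite mxE mul0r].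
apply/eqP => r0; have := dotv_row3 a' b' c' a' b' c'; rewrite h3 r0.
by rewrite /dotv big1 => [|i _]; [lia|rewrite mxE mul0r].
Qed.

(* (z1 + i z2, z1 - i z2, i z3) for z = theta + i eta. *)
Definition iso_of (w : 'rV[int]_3 * 'rV[int]_3) : gint * (gint * gint) :=
  let: (t, e) := w in
  (Gint (t 0 0 - e 0 1) (e 0 0 + t 0 1),
   (Gint (t 0 0 + e 0 1) (e 0 0 - t 0 1), Gint (- e 0 2%:R) (t 0 2%:R))).

(** z1 = (A + B) / 2, z2 = (A - B) / (2 i) and z3 = - i C; the integer divisions are exact when A =
    B mod 2. *)
Definition of_iso (s : gint * (gint * gint)) : 'rV[int]_3 * 'rV[int]_3 :=
  let: (A, (B, C)) := s in
  (row3 (divz (gre A + gre B) 2) (divz (gim A - gim B) 2) (gim C),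
   row3 (divz (gim A + gim B) 2) (divz (gre B - gre A) 2) (- gre C)).

Lemma iso_of_row3 a b c a' b' c' :
  iso_of (row3 a b c, row3 a' b' c') =
  (Gint (a - b') (a' + b), (Gint (a + b') (a' - b), Gint (- c') c)).
Proof. by rewrite /iso_of !mxE. Qed.

Lemma gn_Gint a b : (gn (Gint a b))%:Z = a * a + b * b.
Proof. by rewrite gnE !expr2. Qed.

Lemma iso_of_isotropic M w : (0 < M)%N -> twin_pairs M w -> isotropic M (iso_of w).
Proof.
case: w => [t e] M0; rewrite (row3E t) (row3E e).
move: (t 0 0) (t 0 1) (t 0 2%:R) (e 0 0) (e 0 1) (e 0 2%:R) => a b c a' b' c'.
rewrite iso_of_row3 => /(twin_pairs_row3 _ _ _ _ _ _ M0)[h1 h2 h3]; split.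
- by rewrite !gmulE /=; congr Gint; lia.
- by exists (Gint (- b') b); apply: gintP; rewrite ?gmulE /=; lia.
- cbn [fst snd]; have e1 := gn_Gint (a - b') (a' + b); have e2 := gn_Gint (a + b') (a' - b).
  by have e3 := gn_Gint (- c') c; lia.
Qed.

Lemma cnt_twin_pairs M : (0 < M)%N -> cnt (twin_pairs M) = cnt (isotropic M).
Proof.
move=> M0; apply: (@cnt_eq _ _ _ _ iso_of of_iso).
- by move=> w; exact: iso_of_isotropic.
- move=> [A [B C]] [/= hm [[d d'] hd] hn].
  apply/(twin_pairs_row3 _ _ _ _ _ _ M0).
  have hn' : gre A ^+ 2 + gim A ^+ 2 + (gre B ^+ 2 + gim B ^+ 2) +
    2 * (gre C ^+ 2 + gim C ^+ 2) = 4 * M%:Z by rewrite -!gnE; lia.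
  have /= hr := congr1 gre hm; have /= hi := congr1 gim hm.
  have /= dr := congr1 gre hd; have /= di := congr1 gim hd.
  have -> : divz (gre A + gre B) 2 = gre B + d by lia.
  have -> : divz (gim A - gim B) 2 = d' by lia.
  have -> : divz (gim A + gim B) 2 = gim B + d' by lia.
  have -> : divz (gre B - gre A) 2 = - d by lia.
  have eA1 : gre A = gre B + 2 * d by lia.
  have eA2 : gim A = gim B + 2 * d' by lia.
  move: hr hi hn'; rewrite eA1 eA2 !expr2; move: (gre B) (gim B) (gre C) (gim C) => x y p q.
  by move=> hr hi hn'; split; lia.
- move=> [t e] _; rewrite (row3E t) (row3E e) iso_of_row3 /of_iso /=.
  by congr pair; congr row3; lia.
- move=> [A [B C]] [_ [[d d'] hd] _]; rewrite /of_iso iso_of_row3.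
  have /= dr := congr1 gre hd; have /= di := congr1 gim hd.
  by congr (_, (_, _)); apply: gintP => /=; lia.
Qed.

Lemma Twin_sum M : (0 < M)%N -> (Twin M)%:R =
  \sum_(k <- divisors M | odd k && (k ^ 2 %| M)%N) chi_sum (M %/ k ^ 2) * num_prim k.
Proof.
move=> M0; have := cnt_param_dom M0.
rewrite (@cnt_fibers_const _ _ (param_dom M) (isotropic M) param 4%:R); last first.
- by move=> t; exact: cnt_param_fiber.
- by move=> t; exact: param_isotropic.
- exact: finite_isotropic.
- exact: finite_param_dom.
rewrite -cnt_twin_pairs // cnt_fset_set; last exact: finite_twin_pairs.
rewrite -/(Twin M) => e; apply: (@mulfI _ 4%:R) => //; rewrite e mulr_sumr.
apply: eq_bigr => k /andP[_ kM]; rewrite R2E; first by ring.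
by rewrite divn_gt0 ?(dvdn_gt0 M0 kM) // dvdn_leq.
Qed.

(** M = |h|^2 k^2 is the norm of the Gaussian integer k h. *)
Lemma twins_sum_two_squares M (t e : 'rV[int]_3) : (0 < M)%N ->
  twins t e -> normv t = M%:Z -> exists a b : int, M%:Z = a ^+ 2 + b ^+ 2.
Proof.
move=> M0 te tM.
have XM : isotropic M (iso_of (t, e)).
  by apply: iso_of_isotropic => //; split=> //=; case: te => _ _ _ <-.
have [[h [u v]] [[k [/= _ <- _ _]] _]] := param_surj M0 XM.
exists (gre h * k%:Z), (gim h * k%:Z).
by rewrite PoszM gnE -mulnn PoszM; ring.
Qed.

End TwinsAsIsotropic.

(** * Multiplicativity *)

Section Multiplicativity.
Local Open Scope ring_scope.

Lemma multiplicative_chi_sum : multiplicative_fun chi_sum.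
Proof.
split; first by rewrite /chi_sum big_seq1.
move=> a b a0 b0 ab; rewrite /chi_sum sum_divisorsM // mulr_suml.
apply: eq_bigr => d _; rewrite mulr_sumr; apply: eq_bigr => e _; exact: chiM.
Qed.

Lemma multiplicative_sigma : multiplicative_fun (fun n => (sigma n)%:R).
Proof.
split; first by rewrite /sigma big_seq1.
move=> a b a0 b0 ab; rewrite /sigma !natr_sum sum_divisorsM // mulr_suml.
apply: eq_bigr => d _; rewrite mulr_sumr; apply: eq_bigr => e _; exact: natrM.
Qed.

Definition psi k : rat := if odd k then num_prim k / 24%:R else 0.

(** As [chi_sum] is 1 * chi and [sigma] is 1 * id, this is chi * psi = id convolved with 1. The
    constant 96 is 4 * 24, from [R2E] and the normalization of [psi]. *)
Lemma sum_chi_sum_psi k : odd k -> \sum_(d <- divisors k) chi_sum d * psi (k %/ d) =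
  (sigma k)%:R.
Proof.
move=> ok; have k0 := odd_gt0 ok; apply: (@mulfI _ 96%:R) => //.
rewrite -sum_R2_num_prim // mulr_sumr; apply: eq_big_seq => d;
  rewrite -dvdn_divisors // => dk.
rewrite R2E ?(dvdn_gt0 k0) // /psi.
have -> : odd (k %/ d) by move: ok; rewrite -{1}(divnK dk) oddM => /andP[].
by field.
Qed.

Lemma psi1 : psi 1 = 1.
Proof.
have := @sum_chi_sum_psi 1 isT; rewrite /sigma !big_seq1 multiplicative_chi_sum.1 mul1r.
by rewrite divn1.
Qed.

Lemma divn_coprime a b d e : coprime a b -> (d %| a)%N -> (e %| b)%N ->
  coprime (a %/ d) (b %/ e).
Proof. by move=> ab da eb;
  apply: coprime_dvdl (dvdn_div da) (coprime_dvdr (dvdn_div eb) ab). Qed.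

Lemma divnMM a b d e : (0 < d)%N -> (0 < e)%N -> (d %| a)%N -> (e %| b)%N ->
  ((a * b) %/ (d * e) = (a %/ d) * (b %/ e))%N.
Proof.
move=> d0 e0 da eb; rewrite -{1}(divnK da) -{1}(divnK eb) mulnACA mulnK //.
by rewrite muln_gt0 d0.
Qed.

(* Expanding sigma(ab) = sigma(a) sigma(b) by [sum_chi_sum_psi], all terms cancel
   by induction except psi(ab) = psi(a) psi(b). *)
Lemma psiM a b : odd a -> odd b -> coprime a b -> psi (a * b) = psi a * psi b.
Proof.
have [n] := ubnP (a * b)%N; elim: n a b => // n IH a b /ltnSE abn oa ob ab.
have a0 := odd_gt0 oa; have b0 := odd_gt0 ob.
pose F d e := chi_sum d * chi_sum e * (psi ((a %/ d) * (b %/ e)) - psi (a %/ d) * psi (b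
  %/ e)).
have F0 d e : (d %| a)%N -> (e %| b)%N -> (d * e)%N != 1%N -> F d e = 0.
  move=> da eb de; rewrite /F IH ?subrr ?mulr0 //.
  - have d0 := dvdn_gt0 a0 da; have e0 := dvdn_gt0 b0 eb.
    rewrite -divnMM //; apply: leq_trans abn.
    have de0 : (0 < d * e)%N by rewrite muln_gt0 d0.
    by apply: ltn_Pdiv; [lia|rewrite muln_gt0 a0].
  - by move: oa; rewrite -{1}(divnK da) oddM => /andP[].
  - by move: ob; rewrite -{1}(divnK eb) oddM => /andP[].
  - exact: divn_coprime.
have S0 : \sum_(d <- divisors a) \sum_(e <- divisors b) F d e = 0.
  have oab : odd (a * b) by rewrite oddM oa.
  have := multiplicative_sigma.2 a b a0 b0 ab;
    rewrite -!sum_chi_sum_psi // sum_divisorsM // mulr_suml.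
  move/eqP; rewrite -subr_eq0 -sumrB => /eqP S; rewrite -[RHS]S.
  apply: eq_big_seq => d; rewrite -dvdn_divisors // => da.
  rewrite mulr_sumr -sumrB; apply: eq_big_seq => e; rewrite -dvdn_divisors // => eb.
  have d0 := dvdn_gt0 a0 da; have e0 := dvdn_gt0 b0 eb.
  rewrite divnMM // multiplicative_chi_sum.2 //;
    last by apply: coprime_dvdl da (coprime_dvdr eb ab).
  by rewrite /F; ring.
rewrite sum_divisors1 // in S0; last first.
  move=> d da d1; rewrite big1_seq // => e /andP[_]; rewrite -dvdn_divisors // => eb.
  by apply: F0 => //; rewrite muln_eq1 negb_and d1.
rewrite sum_divisors1 // in S0; last by move=> e eb e1; apply: F0 => //; rewrite mul1n.
move: S0; rewrite /F !divn1 multiplicative_chi_sum.1 !mul1r => /eqP.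
by rewrite subr_eq0 => /eqP.
Qed.

Lemma multiplicative_psi : multiplicative_fun psi.
Proof.
split; first exact: psi1.
move=> a b _ _ ab; have [/andP[oa ob]|] := boolP (odd a && odd b); first exact: psiM.
rewrite {1}/psi oddM => H; rewrite (negbTE H).
by case/nandP: H => /negbTE ho; rewrite /psi ho ?mul0r ?mulr0.
Qed.

(* [psi k] vanishes at even k. *)
Definition twin_sum M : rat :=
  \sum_(k <- divisors M) if (k ^ 2 %| M)%N then chi_sum (M %/ k ^ 2) * psi k else 0.

Lemma TwinE M : (0 < M)%N -> (Twin M)%:R = 24%:R * twin_sum M.
Proof.
move=> M0; rewrite Twin_sum // big_mkcond mulr_sumr; apply: eq_bigr => k _.
rewrite /psi; case: (odd k) => /=; case: ifP => _; rewrite ?mulr0 //.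
by field.
Qed.

Lemma multiplicative_twin_sum : multiplicative_fun twin_sum.
Proof.
split; first by rewrite /twin_sum big_seq1 divn1 multiplicative_chi_sum.1 psi1.
move=> a b a0 b0 ab; rewrite /twin_sum sum_divisorsM // mulr_suml.
apply: eq_big_seq => d; rewrite -dvdn_divisors // => da.
rewrite mulr_sumr; apply: eq_big_seq => e; rewrite -dvdn_divisors // => eb.
have d0 := dvdn_gt0 a0 da; have e0 := dvdn_gt0 b0 eb.
have cde : coprime d e by apply: coprime_dvdl da (coprime_dvdr eb ab).
have cdb : coprime (d ^ 2) b by rewrite coprimeXl // (coprime_dvdl da).
have cea : coprime (e ^ 2) a by rewrite coprimeXl // coprime_sym (coprime_dvdr eb).
rewrite expnMn Gauss_dvd; last by rewrite coprimeXl // coprimeXr.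
rewrite Gauss_dvdl // Gauss_dvdr //.
case: ifP => [/andP[d2 e2]|]; last first.
  by case: (d ^ 2 %| a)%N; case: (e ^ 2 %| b)%N => //= _; rewrite ?mul0r ?mulr0.
rewrite d2 e2 divnMM ?expn_gt0 ?d0 ?e0 // multiplicative_chi_sum.2 //.
- by rewrite multiplicative_psi.2 //; ring.
- by rewrite divn_gt0 ?(dvdn_gt0 a0 d2) // dvdn_leq.
- by rewrite divn_gt0 ?(dvdn_gt0 b0 e2) // dvdn_leq.
- exact: divn_coprime.
Qed.

(** * Recursions at prime powers *)

Section PrimePowers.
Variables (p : nat) (pr_p : prime p).

Lemma chi_sum_pfactorS j : chi_sum (p ^ j.+1) = 1 + chi p * chi_sum (p ^ j).
Proof.
rewrite /chi_sum !sum_divisorsX // big_ord_recl mulr_sumr; congr (_ + _).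
by apply: eq_bigr => i _; rewrite /= /bump /= add1n expnS chiM.
Qed.

(** The convention [sigma_pred p 0 = 0] makes the recursion valid from j = 0 on. *)
Lemma sigma_pfactorE j : sigma (p ^ j) = (1 + p * sigma_pred p j)%N.
Proof.
case: j => [|j]; first by rewrite muln0 expn0 /sigma big_seq1.
apply/eqP; rewrite -(eqr_nat rat) natrD natrM /= /sigma !natr_sum.
rewrite !sum_divisorsX // big_ord_recl mulr_sumr; apply/eqP; congr (_ + _).
by apply: eq_bigr => i _; rewrite /= /bump /= add1n expnS natrM.
Qed.

Lemma twin_sum_pfactor e :
  twin_sum (p ^ e) = \sum_(j < e.+1) if (j.*2 <= e)%N then chi_sum (p ^ (e - j.*2)) * psi
    (p ^ j) else 0.
Proof.
rewrite /twin_sum sum_divisorsX //; apply: eq_bigr => j _.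
rewrite -expnM muln2 dvdn_Pexp2l ?prime_gt1 //; case: ifP => // je.
by rewrite -{1}(subnK je) expnD mulnK // expn_gt0 prime_gt0.
Qed.

Lemma twin_sum_pfactor1 : twin_sum (p ^ 1) = 1 + chi p.
Proof.
rewrite twin_sum_pfactor !big_ord_recl big_ord0 /= !addr0 psi1 mulr1.
by rewrite chi_sum_pfactorS expn0 multiplicative_chi_sum.1 mulr1.
Qed.

Hypothesis p2 : (2 < p)%N.

Let odd_p : odd p.
Proof. by case: (even_prime pr_p) p2 => [->|]. Qed.

(** Since chi_sum(p^(j+1)) - chi(p) chi_sum(p^j) = 1, subtracting chi(p) times the convolution
    identity at p^(n-1) from the one at p^n removes the weights. *)
Lemma sum_psi_pfactor n :
  \sum_(i < n.+1) psi (p ^ i) = (sigma (p ^ n))%:R - chi p * (sigma_pred p n)%:R.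
Proof.
have T m : \sum_(i < m.+1) chi_sum (p ^ (m - i)) * psi (p ^ i) = (sigma (p ^ m))%:R.
  rewrite -sum_chi_sum_psi ?oddX ?odd_p ?orbT // sum_divisors_rev ?expn_gt0 ?prime_gt0 //.
  rewrite sum_divisorsX //; apply: eq_bigr => i _; have im := ltn_ord i; rewrite ltnS in im.
  have e1 : (p ^ m = p ^ i * p ^ (m - i))%N by rewrite -expnD subnKC.
  have pX_gt0 j : (0 < p ^ j)%N by rewrite expn_gt0 prime_gt0.
  by rewrite e1 mulKn // mulnK.
case: n => [|n]; first by rewrite big_ord_recl big_ord0 addr0 psi1 mulr0 subr0 /sigma
  big_seq1.
rewrite /= -!T !(big_ord_recr n.+1) /= subnn mulr_sumr expn0 multiplicative_chi_sum.1 mul1r.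
rewrite addrAC; congr (_ + _); rewrite -sumrB; apply: eq_bigr => i _.
have i_n : (i <= n)%N by rewrite -ltnS ltn_ord.
by rewrite subSn // chi_sum_pfactorS; move: (chi_sum _) (psi _) (chi p) => x y z; ring.
Qed.

(** Thus psi(p^n) = p^(n-1) (p - chi(p)) for n > 0: the geometric growth has one exception, at the
    first step. *)
Lemma psi_pfactorS n : psi (p ^ n.+1) = p%:R * psi (p ^ n) - (if n is 0 then chi p else 0).
Proof.
have D m : psi (p ^ m.+1) = (sigma (p ^ m.+1))%:R - (sigma (p ^ m))%:R
    - chi p * ((sigma (p ^ m))%:R - (sigma_pred p m)%:R).
  have := sum_psi_pfactor m.+1; rewrite big_ord_recr /= sum_psi_pfactor => h.
  apply: (addrI ((sigma (p ^ m))%:R - chi p * (sigma_pred p m)%:R)); rewrite h /=.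
  by move: (chi p) (sigma _)%:R (sigma _)%:R (sigma_pred _ _)%:R => x y z t; ring.
case: n => [|n].
  rewrite D (sigma_pfactorE 1) (sigma_pfactorE 0) /= expn0 psi1 (sigma_pfactorE 0) /=
    muln0 addn0.
  by rewrite muln1 natrD; move: (chi p) p%:R => x y; ring.
rewrite !D (sigma_pfactorE n.+2) /= (sigma_pfactorE n.+1) /= (sigma_pfactorE n).
by rewrite !(natrD, natrM); move: (chi p) p%:R (sigma_pred _ _)%:R => x y z; ring.
Qed.

(** The term j = 0 gives chi_sum(p^(e+2)); shifting j by one in the others multiplies by p, and the
    exceptional first step of [psi_pfactorS] leaves - chi(p) chi_sum(p^e). *)
Lemma twin_sum_pfactorSS e :
  twin_sum (p ^ e.+2) = chi_sum (p ^ e.+2) + p%:R * twin_sum (p ^ e) - chi p * chi_sum (p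
    ^ e).
Proof.
rewrite !twin_sum_pfactor big_ord_recl /= psi1 mulr1 subn0 -addrA; congr (_ + _).
(* The last index is j = e + 2, where 2 j > e + 2. *)
rewrite big_ord_recr /= ifF ?addr0; last by rewrite /bump /= add1n -addnn; lia.
rewrite big_ord_recl [in RHS]big_ord_recl /= /bump /= subn0 !psi_pfactorS !subSS subn0
  expn0 psi1.
rewrite mulr1 mulrDr.
transitivity (chi_sum (p ^ e) * (p%:R - chi p) + p%:R * \sum_(i < e)
   if ((bump 0 i).*2 <= e)%N then chi_sum (p ^ (e - (bump 0 i).*2)) * psi (p ^ (bump 0
     i)) else 0); last by ring.
congr (_ + _); first by rewrite [RHS]mulrDr.
rewrite mulr_sumr; apply: eq_bigr => i _.
rewrite /bump /= !add1n !doubleS !ltnS !subSS; case: ifP => _; last by rewrite mulr0.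
by rewrite psi_pfactorS; ring.
Qed.

End PrimePowers.

End Multiplicativity.

(** * Local factors *)

Section LocalFactors.
Local Open Scope ring_scope.

Lemma coprime_prod_ord a n (F : 'I_n -> nat) :
  (forall i, coprime a (F i)) -> coprime a (\prod_i F i)%N.
Proof.
move=> aF; apply: (big_ind (coprime a)) => //; first exact: coprimen1.
by move=> x y ax ay; rewrite coprimeMr ax.
Qed.

Lemma multiplicative_prod (f : nat -> rat) n (F : 'I_n -> nat) :
  multiplicative_fun f -> (forall i, 0 < F i)%N ->
  (forall i j, i != j -> coprime (F i) (F j)) ->
  f (\prod_i F i)%N = \prod_i f (F i).
Proof.
move=> [f1 fM]; elim: n F => [|n IH] F F0 cF; first by rewrite !big_ord0.
rewrite !big_ord_recl fM ?IH //.
- by move=> i j ij; apply: cF; rewrite (inj_eq lift_inj).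
- by rewrite prodn_gt0.
- by apply: coprime_prod_ord => i; apply: cF; rewrite neq_lift.
Qed.

(** Only j = 0 survives because [psi] vanishes at even numbers, and chi(2) = 0 gives chi_sum(2^k) =
    1. *)
Lemma twin_sum_pow2 k : twin_sum (2 ^ k) = 1.
Proof.
rewrite twin_sum_pfactor // big_ord_recl /= psi1 mulr1 subn0 big1 => [|i _]; last first.
  by rewrite /psi oddX /=; case: ifP; rewrite ?mulr0.
by case: k => [|k]; rewrite addr0 ?chi_sum_pfactorS // ?multiplicative_chi_sum.1 // mul0r
  addr0.
Qed.

Lemma chi_sum_pfactor_3mod4 q e : prime q -> chi q = -1 -> chi_sum (q ^ e) = (~~ odd e)%:R.
Proof.
move=> pr_q q3; elim: e => [|e IH]; first by rewrite multiplicative_chi_sum.1.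
by rewrite chi_sum_pfactorS // IH q3 /=; case: (odd e);
  rewrite /= ?mulr0 ?mulr1 ?addr0 // addrN.
Qed.

Lemma nat_ind2 (Q : nat -> Prop) :
  Q 0%N -> Q 1%N -> (forall n, Q n -> Q n.+2) -> forall n, Q n.
Proof.
move=> Q0 Q1 QS n; suff [] : Q n /\ Q n.+1 by [].
by elim: n => [|n [Qn QSn]]; split=> //; exact: QS.
Qed.

(** With chi(p) = 1 the two [chi_sum] terms of the recursion differ by 2, so each step by two
    exponents is x -> 2 + p x; both parities of [g] obey this by [sigma_pfactorE]. *)
Lemma twin_sum_pfactor_1mod4 p e : prime p -> p = 1 %[mod 4] -> twin_sum (p ^ e) = (g p
  e)%:R.
Proof.
move=> pr_p p1; have c1 : chi p = 1 by rewrite /chi p1.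
have p2 : (2 < p)%N by case: p pr_p p1 {c1} => [|[|[|]]].
elim/nat_ind2: e => [||e IH].
- by rewrite multiplicative_twin_sum.1 /g /= expn0 /sigma big_seq1.
- by rewrite twin_sum_pfactor1 // c1 /g /= expn0 /sigma big_seq1.
rewrite twin_sum_pfactorSS // IH !chi_sum_pfactorS // c1 /g /= negbK.
case: ifP => _; rewrite (sigma_pfactorE pr_p e./2.+1) /= ?(sigma_pfactorE pr_p e./2).
  by rewrite !(natrD, natrM); ring.
by rewrite !(natrD, natrM); ring.
Qed.

(** At odd exponents both [chi_sum] terms vanish and the starting value 1 + chi(q) is 0, so zero
    propagates; at even exponents the terms add up to 2, as for [g]. *)
Lemma twin_sum_pfactor_3mod4 q e : prime q -> q = 3 %[mod 4] -> twin_sum (q ^ e) = (h q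
  e)%:R.
Proof.
move=> pr_q q3; have c3 : chi q = -1 by rewrite /chi q3.
have q2 : (2 < q)%N by case: q pr_q q3 {c3} => [|[|[|]]].
elim/nat_ind2: e => [||e IH].
- by rewrite multiplicative_twin_sum.1 /h /= expn0 /sigma big_seq1.
- by rewrite twin_sum_pfactor1 // c3 /h /= addrN.
rewrite twin_sum_pfactorSS // IH !(chi_sum_pfactor_3mod4 _ pr_q c3) c3 /h /= negbK.
case: ifP => _ /=; first by rewrite mulr0n; ring.
rewrite (sigma_pfactorE pr_q e./2.+1) /= ?(sigma_pfactorE pr_q e./2).
by rewrite !(natrD, natrM); ring.
Qed.

Lemma multiplicative_Twin : multiplicative_fun (fun M => (Twin M)%:R / 24%:R).
Proof.
have E M : (0 < M)%N -> (Twin M)%:R / 24%:R = twin_sum M by move=> M0; rewrite TwinE //;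
  field.
split; first by rewrite E // multiplicative_twin_sum.1.
by move=> a b a0 b0 ab; rewrite !E ?muln_gt0 ?a0 // multiplicative_twin_sum.2.
Qed.

End LocalFactors.

Theorem theorem5p10 :
  (forall (M kappa m l : nat) (p lambda : 'I_m -> nat) (q mu : 'I_l -> nat),
     0 < M ->
     injective p -> injective q ->
     (forall r : 'I_m, prime (p r) /\ p r = 1 %[mod 4]) ->
     (forall s : 'I_l, prime (q s) /\ q s = 3 %[mod 4]) ->
     (forall r : 'I_m, 0 < lambda r) ->
     (forall s : 'I_l, 0 < mu s) ->
     M = 2 ^ kappa * (\prod_(r < m) p r ^ lambda r)
                   * (\prod_(s < l) q s ^ mu s) ->
     Twin M = 24 * (\prod_(r < m) g (p r) (lambda r))
                 * (\prod_(s < l) h (q s) (mu s)))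
  /\ multiplicative_fun (fun M : nat => ((Twin M)%:R / 24%:R)%R)
  /\ (forall M : nat, 0 < M ->
        (exists theta eta : 'rV[int]_3, twins theta eta /\ normv theta = M%:Z%R) ->
        exists a b : int, (M%:Z = a ^+ 2 + b ^+ 2)%R).
Proof.
split; [|split; [exact: multiplicative_Twin|]]; last first.
  by move=> M M0 [t [e [te tM]]]; exact: twins_sum_two_squares te tM.
move=> M kappa m l p lambda q mu M0 inj_p inj_q hp hq _ _ ME.
have coprime_pfactors a b i j : prime a -> prime b -> a != b -> coprime (a ^ i) (b ^ j).
  move=> pr_a pr_b ab; apply/coprimeXl/coprimeXr.
  by rewrite prime_coprime // dvdn_prime2.
have p_neq2 i : p i != 2 by apply: contra_eqN (hp i).2 => /eqP->.
have q_neq2 j : q j != 2 by apply: contra_eqN (hq j).2 => /eqP->.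
(* The residues 1 and 3 mod 4 separate the two families, so the three parts of M are pairwise
   coprime. *)
have p_neq_q i j : p i != q j.
  by apply/eqP => e; have := (hp i).2; rewrite e (hq j).2.
apply/eqP; rewrite -(eqr_nat rat) TwinE // -mulnA !natrM; apply/eqP.
congr (_ * _)%R.
have p0 : (0 < \prod_(r < m) p r ^ lambda r)%N.
  by apply: prodn_gt0 => i; rewrite expn_gt0 prime_gt0 // (hp i).1.
have q0 : (0 < \prod_(s < l) q s ^ mu s)%N.
  by apply: prodn_gt0 => i; rewrite expn_gt0 prime_gt0 // (hq i).1.
rewrite ME !multiplicative_twin_sum.2 ?muln_gt0 ?expn_gt0 ?p0 ?q0 //; last first.
- apply: coprime_prod_ord => j; rewrite coprimeMl coprime_pfactors ?(hq j).1 1?eq_sym //=.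
  rewrite coprime_sym; apply: coprime_prod_ord => i.
  by rewrite coprime_pfactors ?(hp i).1 ?(hq j).1 // eq_sym.
- by apply: coprime_prod_ord => i; rewrite coprime_pfactors ?(hp i).1 // eq_sym.
rewrite twin_sum_pow2 GRing.mul1r !natr_prod.
rewrite !(multiplicative_prod multiplicative_twin_sum).
- congr (_ * _)%R; apply: eq_bigr => i _.
    exact: twin_sum_pfactor_1mod4 (hp i).1 (hp i).2.
  exact: twin_sum_pfactor_3mod4 (hq i).1 (hq i).2.
- by move=> i; rewrite expn_gt0 prime_gt0 // (hq i).1.
- move=> i j ij; apply: coprime_pfactors; [exact: (hq i).1|exact: (hq j).1|].
  by rewrite (inj_eq inj_q).
- by move=> i; rewrite expn_gt0 prime_gt0 // (hp i).1.
- move=> i j ij; apply: coprime_pfactors; [exact: (hp i).1|exact: (hp j).1|].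
  by rewrite (inj_eq inj_p).
Qed.
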